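(* Let $\phi_0$ denote any convex projection of $f_0$ and let $R := \max(1,\mathfrak{L}(\phi_0))$. There exists a positive constant $C$ depending only on the ratio $c_1/c_2$ such that $$\mathbb{E}_{f_0} \ell^2(\hat{\phi}_{ls}, \phi_0) \leq C \left(\log \frac{en}{2c_1}\right)^{5/4} \min\left[\left(\frac{\sigma^2\sqrt{R}}{n}\right)^{4/5},\ \inf_{\alpha \in \mathcal{P}}\left(\ell^2(\phi_0,\alpha) + \frac{\sigma^2 k^{5/4}(\alpha)}{n}\right)\right]$$ provided $$n \geq C \frac{\sigma^2}{R^2}\left(\log\frac{en}{2c_1}\right)^{5/4}.$$
   Context: Let $\mathcal{C}$ denote the set of all real-valued convex functions on $[0,1]$. Let $n \ge 2$ and let $x_1 < x_2 < \dots < x_n$ be fixed design points in $[0,1]$ satisfying $c_1 \le n(x_i - x_{i-1}) \le c_2$ for $i = 2, \dots, n$, where $c_1, c_2$ are positive constants. We observe $Y_i = f_0(x_i) + \xi_i$, $i=1,\dots,n$, where $f_0$ is an unknown real-valued function on $[0,1]$, not necessarily convex, and $\xi_1,\dots,\xi_n$ are independent normal random variables with mean zero and variance $\sigma^2 > 0$. $\mathbb{E}_{f_0}$ denotes expectation when the true function is $f_0$. The convex least squares estimator $\hat{\phi}_{ls}$ is any minimizer of $\sum_{i=1}^n (Y_i - \psi(x_i))^2$ over $\psi \in \mathcal{C}$ (its values at $x_1,\dots,x_n$ are uniquely determined). A convex projection of $f_0$ is any $\phi_0\in\mathcal{C}$ that minimizes $\sum_{i=1}^n(f_0(x_i)-\psi(x_i))^2$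 over $\psi\in\mathcal{C}$. For real functions $\phi,\psi$ on $[0,1]$, $\ell^2(\phi,\psi) := \frac1n\sum_{i=1}^n(\phi(x_i)-\psi(x_i))^2$ and $\ell$ is its nonnegative square root. For $\phi \in \mathcal{C}$, $\mathfrak{L}(\phi) := \inf\{\ell(\phi,\tau) : \tau \text{ is affine on } [0,1]\}$. A convex function $\alpha$ on $[0,1]$ is piecewise affine if there are an integer $k$ and points $0 = t_0 < t_1 < \dots < t_k = 1$ such that $\alpha$ is affine on each interval $[t_{i-1},t_i]$, $i=1,\dots,k$; $k(\alpha)$ is the smallest such $k$, and $k^{5/4}(\alpha) = (k(\alpha))^{5/4}$. $\mathcal{P}$ is the collection of all piecewise affine convex functions on $[0,1]$. *)

(* Defs.v *)
From HB Require Import structures.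
From mathcomp Require Import all_boot all_order all_algebra.
From mathcomp Require Import all_classical all_reals all_analysis.

Set Implicit Arguments.
Unset Strict Implicit.
Unset Printing Implicit Defensive.

Import Order.TTheory GRing.Theory Num.Theory.

Local Open Scope classical_set_scope.
Local Open Scope ring_scope.

(* Real functions on [0,1] are represented by total functions R -> R; every
   notion below only looks at their values on [0,1]. *)

Definition convex01 (R : realType) (f : R -> R) : Prop :=
  @convex_function R R^o `[0, 1] f.

Definition affine_on (R : realType) (D : set R) (f : R -> R) : Prop :=
  exists a b : R, forall x, D x -> f x = a * x + b.

(* The design points x_1, ..., x_n are x 0, ..., x (n-1) for x : 'I_n -> R. *)
Definition design (R : realType) (n : nat) (c1 c2 : R) (x : 'I_n -> R) : Prop :=
  [/\ forall i, 0 <= x i <= 1,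
      forall i j : 'I_n, (i < j)%N -> x i < x j &
      forall i j : 'I_n, j = i.+1 :> nat ->
        c1 <= n%:R * (x j - x i) <= c2].

(* g minimizes \sum_i (y_i - psi(x_i))^2 over convex functions psi.  With y the
   vector of observations, g is a convex least squares estimator; with
   y_i = f0(x_i), g is a convex projection of f0. *)
Definition convex_lse (R : realType) (n : nat) (x : 'I_n -> R) (y : 'I_n -> R)
    (g : R -> R) : Prop :=
  convex01 g /\
  forall psi : R -> R, convex01 psi ->
    \sum_(i < n) (y i - g (x i)) ^+ 2 <= \sum_(i < n) (y i - psi (x i)) ^+ 2.

Definition convex_projection (R : realType) (n : nat) (x : 'I_n -> R)
    (f0 phi0 : R -> R) : Prop :=
  convex_lse x (fun i => f0 (x i)) phi0.

Definition ell2 (R : realType) (n : nat) (x : 'I_n -> R) (phi psi : R -> R) : R :=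
  n%:R^-1 * \sum_(i < n) (phi (x i) - psi (x i)) ^+ 2.

Definition ell (R : realType) (n : nat) (x : 'I_n -> R) (phi psi : R -> R) : R :=
  Num.sqrt (ell2 x phi psi).

Definition dist_affine (R : realType) (n : nat) (x : 'I_n -> R)
    (phi : R -> R) : R :=
  inf [set ell x phi tau | tau in affine_on `[0, 1]].

Definition affine_pieces (R : realType) (alpha : R -> R) (k : nat) : Prop :=
  exists t : nat -> R,
    [/\ t 0%N = 0, t k = 1,
        forall i, (i < k)%N -> t i < t i.+1 &
        forall i, (i < k)%N -> affine_on `[t i, t i.+1] alpha].

Definition pw_affine_convex (R : realType) : set (R -> R) :=
  [set alpha | convex01 alpha /\ exists k, affine_pieces alpha k].

(* The least k with affine_pieces alpha k (junk value 0 if there is none). *)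
Definition num_pieces (R : realType) (alpha : R -> R) : nat :=
  xget 0%N [set k | affine_pieces alpha k /\
                    forall j, affine_pieces alpha j -> (k <= j)%N].

Definition mutually_independent (R : realType) (d : measure_display)
    (T : measurableType d) (P : probability T R) (n : nat)
    (X : 'I_n -> {RV P >-> R}) : Prop :=
  forall (J : {set 'I_n}) (B : 'I_n -> set R),
    (forall i, measurable (B i)) ->
    P (\bigcap_(i in [set` J]) (X i @^-1` B i)) =
    (\prod_(i in J) P (X i @^-1` B i))%E.

(* The second parameter of normal_prob is the standard deviation. *)
Definition iid_normal (R : realType) (d : measure_display)
    (T : measurableType d) (P : probability T R) (n : nat) (sigma : R)
    (xi : 'I_n -> {RV P >-> R}) : Prop :=
  mutually_independent xi /\
  forall i (B : set R), measurable B ->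
    distribution P (xi i) B = normal_prob 0 sigma B.

(* Main.v *)
Require Import Defs.
From HB Require Import structures.
From mathcomp Require Import all_boot all_order all_algebra.
From mathcomp Require Import all_classical all_reals all_analysis.
From mathcomp Require Import measurable_realfun ring lra zify.

Set Implicit Arguments.
Unset Strict Implicit.
Unset Printing Implicit Defensive.

Import Order.TTheory GRing.Theory Num.Theory.

Local Open Scope classical_set_scope.
Local Open Scope ring_scope.

(** Let [D] be the vector of values of [phi_ls - phi0] at the design points.
    Both functions are projections onto the cone of convex vectors, hence
    [|D|^2 <= <xi, D>], and misspecification plays no role any more.

    The noise is controlled on a stretch of [m] consecutive design points.  Cut
    the stretch into dyadic annuli according to the distance [2^t] to its
    nearest end point, and every annulus into [2^kap] cells per side.  On a cell,
    split a vector into its affine part and the rest.  The affine parts of all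
    cells live in a fixed space of dimension [O(2^kap log n)].  A convex function
    is affine plus a nonnegative combination of hinges [(. - x_j)_+], whose
    coefficients are the slope jumps ([kink]); the rest only sees the hinge on
    the cell of [x_j], so it is bounded by the largest of [3 m] Gaussian
    variables times a weighted sum of the slope jumps.  Comparing slopes across
    the annulus [2^(t-1) <= dist < 2^t] bounds the slope jumps further inside by
    the norm of the function on that annulus, and since the annuli are disjoint
    the weighted sum is [O(2^(-3 kap/2) sqrt (log n))] times the norm of the
    function.

    For the bound with [alpha], apply this on each piece to [phi_ls - alpha],
    which is convex there, with [2^kap ~ (log n)^(1/4)].  For the rate, apply it
    to [phi_ls - tau] and [phi0 - tau] with [tau] a nearly optimal affine
    function and [2^kap ~ z], where [z^5 = n Rad^2 / sigma^2].  Expectations are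
    taken of exponentials of linear forms of the noise only: they dominate both
    squares and maxima of squares of such forms. *)

(** * Least squares affine fits and convex sequences *)

(** Cauchy-Schwarz, from the nonnegativity of the quadratic polynomial [\sum (a i * t - b i) ^+ 2]
    in [t]. *)
Lemma sum_mul_le_sqrt (R : rcfType) (I : finType) (P : pred I) (a b : I -> R) :
  \sum_(i | P i) a i * b i <=
  Num.sqrt (\sum_(i | P i) a i ^+ 2) * Num.sqrt (\sum_(i | P i) b i ^+ 2).
Proof.
set A := \sum_(i | P i) a i ^+ 2; set B := \sum_(i | P i) b i ^+ 2.
have A0 : 0 <= A by apply: sumr_ge0 => i _; exact: sqr_ge0.
have B0 : 0 <= B by apply: sumr_ge0 => i _; exact: sqr_ge0.
set S := \sum_(i | P i) a i * b i.
rewrite -sqrtrM//; apply: le_trans (ler_norm _) _; rewrite -sqrtr_sqr.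
rewrite ler_sqrt ?mulr_ge0//.
have key (t : R) : 0 <= A * t ^+ 2 - 2 * S * t + B.
  have -> : A * t ^+ 2 - 2 * S * t + B = \sum_(i | P i) (a i * t - b i) ^+ 2.
    rewrite /A /B /S mulr_suml mulr_sumr mulr_suml -sumrB -big_split/=.
    by apply: eq_bigr => i _; ring.
  by apply: sumr_ge0 => i _; exact: sqr_ge0.
have [A_eq0|A_neq0] := eqVneq A 0.
  have [->|S0] := eqVneq S 0; first by rewrite expr0n/= mulr_ge0.
  (* With [A = 0] the polynomial is affine in [t]; for [S != 0] it takes the value [-1] at this
     point. *)
  have := key ((B + 1) / (2 * S)); rewrite A_eq0 mul0r.
  have -> : 0 - 2 * S * ((B + 1) / (2 * S)) + B = - 1 by field.
  lra.
have A_gt0 : 0 < A by rewrite lt_neqAle eq_sym A_neq0.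
have := key (S / A).
have -> : A * (S / A) ^+ 2 - 2 * S * (S / A) + B = (A * B - S ^+ 2) / A by field.
by rewrite pmulr_lge0 ?invr_gt0// subr_ge0.
Qed.

(** [e1] and [e2] are the normalised constant and the normalised centred [X] on [A], extended by
    zero: in general an orthonormal basis of the affine vectors on [A]. The two claims are Bessel's
    inequality and Parseval's identity for affine [u]. If [A] is empty or [X] is constant on it,
    division by zero makes the degenerate vector vanish, and both claims survive. *)
Lemma affine_frame (R : rcfType) (m : nat) (A : pred 'I_m) (X : nat -> R) :
  exists e1 e2 : nat -> R,
    (forall u : nat -> R,
      (\sum_(i < m) u i * e1 i) ^+ 2 + (\sum_(i < m) u i * e2 i) ^+ 2 <=
      \sum_(i < m | A i) u i ^+ 2) /\
    (forall (x u : nat -> R) (a b : R),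
      (forall i : 'I_m, A i -> u i = a * X i + b) ->
      \sum_(i < m | A i) x i * u i =
      (\sum_(i < m) x i * e1 i) * (\sum_(i < m) u i * e1 i) +
      (\sum_(i < m) x i * e2 i) * (\sum_(i < m) u i * e2 i)).
Proof.
pose c : R := \sum_(i < m | A i) 1.
pose mu := (\sum_(i < m | A i) X i) / c.
pose y (i : nat) := X i - mu.
pose D := \sum_(i < m | A i) y i ^+ 2.
pose A' (k : nat) := if insub k is Some i then A i else false.
have A'E (i : 'I_m) : A' i = A i by rewrite /A' valK.
exists (fun i => if A' i then (Num.sqrt c)^-1 else 0).
exists (fun i => if A' i then y i / Num.sqrt D else 0).
have e1E (u : nat -> R) : \sum_(i < m) u i * (if A' i then (Num.sqrt c)^-1 else 0) =
    (\sum_(i < m | A i) u i) / Num.sqrt c.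
  rewrite mulr_suml [RHS]big_mkcond; apply: eq_bigr => i _.
  by rewrite A'E; case: (A i); rewrite ?mulr0.
have e2E (u : nat -> R) : \sum_(i < m) u i * (if A' i then y i / Num.sqrt D else 0) =
    (\sum_(i < m | A i) u i * y i) / Num.sqrt D.
  rewrite mulr_suml [RHS]big_mkcond; apply: eq_bigr => i _.
  by rewrite A'E; case: (A i); rewrite ?mulr0 ?mulrA.
have c0 : 0 <= c by apply: sumr_ge0.
have D0 : 0 <= D by apply: sumr_ge0 => i _; exact: sqr_ge0.
have ycase (x : nat -> R) : D = 0 -> \sum_(i < m | A i) x i * y i = 0.
  move=> /eqP; rewrite psumr_eq0; last by move=> i _; exact: sqr_ge0.
  move=> /allP yD; apply: big1 => i Ai.
  have := yD i (mem_index_enum _); rewrite Ai/= sqrf_eq0 => /eqP ->.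
  by rewrite mulr0.
have ccase (x : nat -> R) : c = 0 -> \sum_(i < m | A i) x i = 0.
  move=> /eqP; rewrite psumr_eq0; last by [].
  move=> /allP yD; apply: big1 => i Ai.
  by have := yD i (mem_index_enum _); rewrite Ai/= oner_eq0.
have muc : mu * c = \sum_(i < m | A i) X i.
  rewrite /mu; have [c_eq0|cn0] := eqVneq c 0; first by rewrite c_eq0 mulr0 ccase.
  by rewrite divfK.
have sumy : \sum_(i < m | A i) y i = 0.
  rewrite /y sumrB -muc /c mulr_sumr.
  by under [X in _ - X]eq_bigr do rewrite -[mu]mulr1; rewrite subrr.
have sqc : Num.sqrt c ^+ 2 = c by rewrite sqr_sqrtr.
have sqD : Num.sqrt D ^+ 2 = D by rewrite sqr_sqrtr.
split=> [u|x u a b uE]; rewrite !e1E !e2E.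
  rewrite !expr_div_n sqc sqD.
  set S1 := \sum_(i < m | A i) u i; set S2 := \sum_(i < m | A i) u i * y i.
  (* The squared residual of an arbitrary affine fit [al + be * y]; inserting the least squares
     coefficients gives Bessel's inequality. *)
  have key (al be : R) : 0 <= \sum_(i < m | A i) u i ^+ 2 + al ^+ 2 * c +
      be ^+ 2 * D + (- 2 * al) * S1 + (- 2 * be) * S2 +
      2 * al * be * \sum_(i < m | A i) y i.
    rewrite /c /D /S1 /S2 !mulr_sumr -!big_split/=.
    apply: sumr_ge0 => i _.
    have := sqr_ge0 (u i - al - be * y i); congr (0 <= _); ring.
  have h1 : (S1 / c) ^+ 2 * c = S1 ^+ 2 / c /\ S1 / c * S1 = S1 ^+ 2 / c.
    have [cz|cn] := eqVneq c 0; last by split; field.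
    by rewrite /S1 ccase// !mul0r expr0n/= !mul0r.
  have h2 : (S2 / D) ^+ 2 * D = S2 ^+ 2 / D /\ S2 / D * S2 = S2 ^+ 2 / D.
    have [cz|cn] := eqVneq D 0; last by split; field.
    by rewrite /S2 ycase// !mul0r expr0n/= !mul0r.
  have := key (S1 / c) (S2 / D); rewrite sumy; case: h1 => h1 h1'; case: h2 => h2 h2'.
  move: h1 h1' h2 h2'; set al := S1 / c; set be := S2 / D => h1 h1' h2 h2'.
  lra.
pose b' := a * mu + b.
have uy i : A i -> u i = a * y i + b' by move=> /uE ->; rewrite /y /b'; ring.
have -> : \sum_(i < m | A i) u i = b' * c.
  rewrite (eq_bigr (fun i : 'I_m => a * y i + b')) => [|i /uy//].
  rewrite big_split/= -mulr_sumr sumy mulr0 add0r /c mulr_sumr.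
  by apply: eq_bigr => i _; rewrite mulr1.
have -> : \sum_(i < m | A i) u i * y i = a * D.
  rewrite (eq_bigr (fun i : 'I_m => a * y i ^+ 2 + b' * y i)) => [|i /uy ->];
    last by ring.
  by rewrite big_split/= -!mulr_sumr sumy mulr0 addr0.
rewrite (eq_bigr (fun i : 'I_m => b' * x i + a * (x i * y i))) => [|i /uy ->];
  last by ring.
rewrite big_split/= -!mulr_sumr; congr (_ + _).
  set S := \sum_(i < m | A i) x i.
  have [cz|cn] := eqVneq c 0; first by rewrite /S ccase// !(mulr0, mul0r).
  rewrite mulrACA -invfM -expr2 sqc; by field.
set S := \sum_(i < m | A i) x i * y i.
have [cz|cn] := eqVneq D 0; first by rewrite /S ycase// !(mulr0, mul0r).
by rewrite mulrACA -invfM -expr2 sqD; field.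
Qed.

(** Monotonicity of consecutive slopes, cross-multiplied so that no division occurs. *)
Definition convex_seq (R : rcfType) (m : nat) (X th : nat -> R) : Prop :=
  forall i j k, (i < j)%N -> (j < k)%N -> (k < m)%N ->
    (th j - th i) * (X k - X j) <= (th k - th j) * (X j - X i).

(** Distance to the nearer end of the stretch, counted from 1 so that its binary logarithm makes
    sense at the end points too. *)
Definition bdist (m j : nat) : nat := minn j.+1 (m - j).

Lemma sum_windows (R : rcfType) (m k c1 c2 : nat) (P : pred nat) (F : nat -> R) :
  (c1 + k <= c2)%N -> (c2 + k <= m)%N -> (forall i, 0 <= F i) ->
  (forall i, (c1 <= i < c1 + k)%N || (c2 <= i < c2 + k)%N -> P i) ->
  \sum_(i < k) F (c1 + i)%N + \sum_(i < k) F (c2 + i)%N <=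
  \sum_(i < m | P i) F i.
Proof.
move=> h1 h2 F0 PF.
have win c : \sum_(i < k) F (c + i)%N = \sum_(c <= i < c + k) F i.
  rewrite -[X in \sum_(X <= _ < _) _]add0n big_addn addKn big_mkord.
  by apply: eq_bigr => i _; rewrite addnC.
rewrite !win -(big_mkord P).
have le1 a b : 0 <= \sum_(a <= i < b | P i) F i.
  by apply: sumr_ge0.
have eqw c : (c1 = c) \/ (c2 = c) ->
    \sum_(c <= i < c + k) F i = \sum_(c <= i < c + k | P i) F i.
  move=> hc; rewrite big_nat [RHS]big_nat_cond big_mkcond [RHS]big_mkcond.
  apply: eq_bigr => i _; case: ifP => //= hi; rewrite PF//.
  by case: hc => ->; rewrite hi ?orbT.
rewrite (eqw c1) ?(eqw c2); [|by right|by left].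
rewrite (@big_cat_nat _ _ _ c1 0 m)//=; last by lia.
rewrite (@big_cat_nat _ _ _ (c1 + k) c1 m)//=; [|by lia..].
rewrite (@big_cat_nat _ _ _ c2 (c1 + k) m)//=; last by lia.
rewrite (@big_cat_nat _ _ _ (c2 + k) c2 m)//=; last by lia.
have := le1 0 c1; have := le1 (c1 + k) c2; have := le1 (c2 + k) m; lra.
Qed.

Section convex_sequences.
Variables (R : rcfType) (m : nat) (X : nat -> R) (g1 g2 : R).
Hypothesis g1_gt0 : 0 < g1.
Hypothesis gap : forall i, (i.+1 < m)%N -> g1 <= X i.+1 - X i <= g2.

Lemma gap_ge (i j : nat) : (i <= j)%N -> (j < m)%N ->
  (j - i)%:R * g1 <= X j - X i <= (j - i)%:R * g2.
Proof.
elim: j => [|j IH] ij jm.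
  by move: ij; rewrite leqn0 => /eqP ->; rewrite subrr !mul0r lexx.
move: ij; rewrite leq_eqVlt => /predU1P[->|ij]; first by rewrite subnn subrr !mul0r lexx.
have /andP[h1 h2] := IH ij (ltnW jm); have /andP[h3 h4] := gap jm.
by rewrite subSn// -natr1; apply/andP; split; nra.
Qed.

Definition slope (th : nat -> R) (i j : nat) := (th j - th i) / (X j - X i).

Definition kink (th : nat -> R) (j : nat) := slope th j j.+1 - slope th j.-1 j.

Lemma X_lt i j : (i < j)%N -> (j < m)%N -> 0 < X j - X i.
Proof.
move=> ij jm; have /andP[h _] := gap_ge (ltnW ij) jm.
by apply: lt_le_trans h; rewrite mulr_gt0// ltr0n subn_gt0.
Qed.

Lemma slope_mono3 th i j k : convex_seq m X th ->
  (i < j)%N -> (j < k)%N -> (k < m)%N ->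
  slope th i j <= slope th j k.
Proof.
move=> cv ij jk km; rewrite /slope.
have h1 := X_lt ij (ltn_trans jk km); have h2 := X_lt jk km.
rewrite ler_pdivrMr// mulrAC ler_pdivlMr//.
by have := cv _ _ _ ij jk km.
Qed.

Lemma slope_mono th i j k l : convex_seq m X th ->
  (i < j)%N -> (j <= k)%N -> (k < l)%N -> (l < m)%N ->
  slope th i j <= slope th k l.
Proof.
move=> cv ij; rewrite leq_eqVlt => /predU1P[<-|jk] kl lm.
  exact: slope_mono3.
by apply: le_trans (slope_mono3 cv ij jk _) (slope_mono3 cv jk kl lm);
  exact: ltn_trans lm.
Qed.

Lemma kink_ge0 th j : convex_seq m X th -> (0 < j)%N -> (j.+1 < m)%N ->
  0 <= kink th j.
Proof.
by case: j => // j cv _ jm; rewrite subr_ge0; apply: slope_mono.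
Qed.

Lemma sum_kink th p e : (p <= e)%N ->
  \sum_(p.+1 <= j < e.+1) kink th j = slope th e e.+1 - slope th p p.+1.
Proof.
elim: e => [|e IH].
  by rewrite leqn0 => /eqP ->; rewrite big_geq// subrr.
rewrite leq_eqVlt => /predU1P[->|pe]; first by rewrite big_geq// subrr.
by rewrite big_nat_recr// IH// /kink/=; ring.
Qed.

(** A discrete Taylor formula: the slope over a gap is the first slope plus all kinks to the left of
    the gap, and the gaps add up to [X i - X j]. *)
Lemma kink_expansion th i : (i < m)%N ->
  th i = th 0%N + slope th 0 1 * (X i - X 0%N) +
    \sum_(1 <= j < i) kink th j * (X i - X j).
Proof.
elim: i => [|i IH] im; first by rewrite big_geq//; ring.
have h0 : X i.+1 - X i != 0 by rewrite gt_eqF// X_lt.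
have step : th i.+1 = th i + slope th i i.+1 * (X i.+1 - X i).
  by rewrite /slope divfK//; ring.
case: i => [|i] in IH im h0 step *.
  by rewrite step big_geq//; ring.
rewrite step [in LHS]IH; last exact: ltnW.
rewrite [in RHS]big_nat_recr//=.
have -> : \sum_(1 <= j < i.+1) kink th j * (X i.+2 - X j) =
    \sum_(1 <= j < i.+1) kink th j * (X i.+1 - X j) +
    (\sum_(1 <= j < i.+1) kink th j) * (X i.+2 - X i.+1).
  by rewrite mulr_suml -big_split/=; apply: eq_bigr => j _; ring.
by rewrite (@sum_kink th 0 i)// /kink/=; ring.
Qed.

(* The sum of the kinks is a difference of two slopes, which is at most the
   slope over [(v, v + h)] minus the slope over [(u, u + h)] whenever [u, u + h]
   lie in the left and [v, v + h] in the right half of the annulus; average over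
   [h] disjoint choices of the pair. *)
Lemma sum_kink_annulus th h : convex_seq m X th -> (0 < h)%N ->
  (\sum_((4 * h).-1 <= j < (m - 4 * h).+1) kink th j) ^+ 2 <=
  4 / (g1 ^+ 2 * h%:R ^+ 3) *
  \sum_(i < m | (2 * h <= bdist m i < 4 * h)%N) th i ^+ 2.
Proof.
move=> cv h0.
set S := \sum_(i < m | _) _; have S0 : 0 <= S.
  by apply: sumr_ge0 => i _; exact: sqr_ge0.
have hR : 0 < h%:R :> R by rewrite ltr0n.
have [emp|nemp] := ltnP (m - 4 * h) (4 * h).-1.
  rewrite big_geq//= expr0n/=.
  by rewrite mulr_ge0// divr_ge0// mulr_ge0// ?sqr_ge0// exprn_ge0 ?ltW.
have -> : (4 * h).-1 = (4 * h - 2).+1 by lia.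
rewrite sum_kink; last by lia.
set W := _ - _.
have W0 : 0 <= W by rewrite subr_ge0; apply: slope_mono => //; lia.
(* The four indices run through four windows of length [h], two at each end, that make up the
   annulus. A slope over [h] steps has a denominator of at least [h * g1]. *)
have bnd i : (i < h)%N -> W ^+ 2 * (h%:R ^+ 2 * g1 ^+ 2) <=
    4 * ((th (m - 4 * h + 1 + i)%N ^+ 2 + th (m - 3 * h + 1 + i)%N ^+ 2) +
         (th (2 * h - 1 + i)%N ^+ 2 + th (3 * h - 1 + i)%N ^+ 2)).
  move=> ih.
  set a := th (2 * h - 1 + i)%N; set b := th (3 * h - 1 + i)%N.
  set c := th (m - 4 * h + 1 + i)%N; set d := th (m - 3 * h + 1 + i)%N.
  have WL : W <= slope th (m - 4 * h + 1 + i) (m - 3 * h + 1 + i) -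
                 slope th (2 * h - 1 + i) (3 * h - 1 + i).
    by apply: lerB; apply: slope_mono => //; lia.
  have absq u v : (u < v)%N -> (v < m)%N -> (v - u = h)%N ->
      `|slope th u v| * (h%:R * g1) <= `|th v| + `|th u|.
    move=> uv vm vu; have /andP[hg _] := gap_ge (ltnW uv) vm.
    have Xp := X_lt uv vm; rewrite vu in hg.
    rewrite /slope normf_div (gtr0_norm Xp) mulrAC ler_pdivrMr//.
    apply: le_trans (ler_wpM2l (normr_ge0 _) hg) _.
    by rewrite ler_wpM2r ?(ltW Xp)//; exact: ler_normB.
  have hg0 : 0 < h%:R * g1 by exact: mulr_gt0.
  have e1 := absq (m - 4 * h + 1 + i)%N (m - 3 * h + 1 + i)%N
    ltac:(lia) ltac:(lia) ltac:(lia).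
  have e2 := absq (2 * h - 1 + i)%N (3 * h - 1 + i)%N
    ltac:(lia) ltac:(lia) ltac:(lia).
  have : W * (h%:R * g1) <= `|a| + `|b| + `|c| + `|d|.
    apply: le_trans (ler_wpM2r (ltW hg0) WL) _.
    rewrite mulrBl.
    have n1 := ler_norm (slope th (m - 4 * h + 1 + i) (m - 3 * h + 1 + i)).
    have n2 := lerNnormlW (lexx `|slope th (2 * h - 1 + i) (3 * h - 1 + i)|).
    have := ler_wpM2r (ltW hg0) n1; have := ler_wpM2r (ltW hg0) n2.
    rewrite /a /b /c /d; lra.
  have : 0 <= W * (h%:R * g1) by rewrite mulr_ge0// ltW.
  rewrite -exprMn -exprMn -(real_normK (num_real a)) -(real_normK (num_real b))
    -(real_normK (num_real c)) -(real_normK (num_real d)).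
  have := normr_ge0 a; have := normr_ge0 b; have := normr_ge0 c; have := normr_ge0 d.
  move: `|a| `|b| `|c| `|d| (W * (h%:R * g1)) => A B C D Z *.
  have : Z ^+ 2 <= (A + B + C + D) ^+ 2 by rewrite ler_sqr ?nnegrE//; lra.
  have := sqr_ge0 (A - B); have := sqr_ge0 (A - C); have := sqr_ge0 (A - D).
  have := sqr_ge0 (B - C); have := sqr_ge0 (B - D); have := sqr_ge0 (C - D).
  nra.
(* Over the [h] shifts every entry of the annulus is used once, while the left side gains the third
   factor [h]. *)
have : \sum_(i < h) W ^+ 2 * (h%:R ^+ 2 * g1 ^+ 2) <= 4 * S.
  apply: le_trans (ler_sum _ (fun (i : 'I_h) _ => bnd i (ltn_ord i))) _.
  rewrite -mulr_sumr ler_wpM2l//.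
  rewrite big_split/= addrC.
  have -> : \sum_(i < h) (th (2 * h - 1 + i)%N ^+ 2 + th (3 * h - 1 + i)%N ^+ 2) =
     \sum_(i < 2 * h) th (2 * h - 1 + i)%N ^+ 2.
    rewrite mul2n -addnn big_split_ord big_split/=; congr (_ + _).
    by apply: eq_bigr => i _; congr (th _ ^+ 2); lia.
  have -> : \sum_(i < h) (th (m - 4 * h + 1 + i)%N ^+ 2 + th (m - 3 * h + 1 + i)%N ^+ 2) =
     \sum_(i < 2 * h) th (m - 4 * h + 1 + i)%N ^+ 2.
    rewrite mul2n -addnn big_split_ord big_split/=; congr (_ + _).
    by apply: eq_bigr => i _; congr (th _ ^+ 2); lia.
  apply: (@sum_windows _ _ _ _ _
    (fun i => (2 * h <= bdist m i < 4 * h)%N) (fun i => th i ^+ 2)).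
  - by lia.
  - by lia.
  - by move=> i; exact: sqr_ge0.
  - by move=> i; rewrite /bdist; lia.
rewrite sumr_const card_ord -[_ *+ h]mulr_natr => key.
rewrite mulrAC ler_pdivlMr; last by rewrite mulr_gt0 ?exprn_gt0.
by apply: le_trans key; rewrite le_eqVlt; apply/orP; left; apply/eqP; ring.
Qed.

End convex_sequences.

(** * Control of the noise on a stretch of design points *)

(* On level [t = blevel j] the cells have [2 ^ (t - kap)] points; truncated
   subtraction makes them singletons as soon as [t <= kap]. *)
Section cells.
Variables (m kap T : nat).

Definition blevel (j : nat) : nat := trunc_log 2 (bdist m j).
Definition bside (j : nat) : bool := (j.+1 <= m - j)%N.
Definition bquot (j : nat) : nat := (bdist m j %/ 2 ^ (blevel j - kap))%N.

Lemma bdist_gt0 j : (j < m)%N -> (0 < bdist m j)%N.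
Proof. rewrite /bdist; lia. Qed.

Lemma blevel_bounds j : (j < m)%N ->
  (2 ^ blevel j <= bdist m j < 2 ^ (blevel j).+1)%N.
Proof. by move=> /bdist_gt0; exact: trunc_log_bounds. Qed.

Hypothesis mT : (m < 2 ^ T)%N.

Lemma blevel_lt j : (j < m)%N -> (blevel j < T)%N.
Proof.
move=> jm; have /andP[h _] := blevel_bounds jm.
rewrite -(@ltn_exp2l 2)//; apply: leq_ltn_trans h _.
by apply: leq_ltn_trans mT; rewrite /bdist; lia.
Qed.

Lemma bquot_lt j : (j < m)%N -> (bquot j < 2 ^ kap.+1)%N.
Proof.
move=> jm; have /andP[_ h] := blevel_bounds jm.
rewrite ltn_divLR ?expn_gt0// -expnD; apply: leq_trans h _.
by rewrite leq_exp2l//; lia.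
Qed.

Definition cell_label : finType := (bool * 'I_T * 'I_(2 ^ kap.+1))%type.

Definition cell (j : 'I_m) : cell_label :=
  (bside j, Ordinal (blevel_lt (ltn_ord j)), Ordinal (bquot_lt (ltn_ord j))).

Lemma cell_eqP (i j : 'I_m) :
  reflect [/\ bside i = bside j, blevel i = blevel j & bquot i = bquot j]
          (cell i == cell j).
Proof.
apply: (iffP eqP) => [[-> hb hq]|[h1 h2 h3]]; first by split.
by rewrite /cell h1; congr (_, _, _); exact: val_inj.
Qed.

Lemma bdist_cell_lt (i j : nat) : blevel i = blevel j -> bquot i = bquot j ->
  (bdist m j < bdist m i + 2 ^ (blevel j - kap))%N.
Proof.
rewrite /bquot => -> hq; set s := (2 ^ _)%N in hq *.
have s0 : (0 < s)%N by rewrite expn_gt0.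
have := divn_eq (bdist m i) s; have := divn_eq (bdist m j) s.
by have := ltn_pmod (bdist m j) s0; rewrite hq; lia.
Qed.

Lemma cell_width (i j : 'I_m) : cell i = cell j -> (i < j)%N ->
  (j < i + 2 ^ (blevel j - kap))%N.
Proof.
move=> /eqP/cell_eqP[hs hb hq] ij.
have h1 := bdist_cell_lt hb hq.
have := bdist_cell_lt (esym hb) (esym hq); rewrite hb => h2.
have := ltn_ord i; have := ltn_ord j.
by move: hs h1 h2; rewrite /bside /bdist; lia.
Qed.

(** On one side [bdist] is monotone; the level is monotone in [bdist] and, at a fixed level, so is
    the quotient. Hence all three labels are constant between two equal ones. *)
Lemma cell_interval (i j k : 'I_m) : cell i = cell k -> (i < j < k)%N ->
  cell j = cell i.
Proof.
move=> /eqP/cell_eqP[hs hb hq] /andP[ij jk].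
have im := ltn_ord i; have jm := ltn_ord j; have km := ltn_ord k.
have hsj : bside j = bside i by move: hs; rewrite /bside; lia.
have [d1 d2] : (minn (bdist m i) (bdist m k) <= bdist m j)%N /\
    (bdist m j <= maxn (bdist m i) (bdist m k))%N.
  by move: hs hsj; rewrite /bside /bdist; lia.
have hbj : blevel j = blevel i.
  have lt0 := bdist_gt0 im; have lt1 := bdist_gt0 km.
  apply/eqP; rewrite eqn_leq; apply/andP; split.
    apply: leq_trans (leq_trunc_log 2 d2) _.
    by rewrite /maxn; case: ifP => _; rewrite -?[trunc_log _ _]/(blevel _) ?hb.
  apply: leq_trans _ (leq_trunc_log 2 d1).
  by rewrite /minn; case: ifP => _; rewrite -?[trunc_log _ _]/(blevel _) ?hb.
apply/eqP/cell_eqP; split => //.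
move: hq; rewrite /bquot hbj -hb => hq.
set s := (2 ^ _)%N in hq *; apply/eqP; rewrite eqn_leq; apply/andP; split.
  apply: leq_trans (leq_div2r s d2) _.
  by rewrite /maxn; case: ifP => _; rewrite ?hq.
apply: leq_trans _ (leq_div2r s d1).
by rewrite /minn; case: ifP => _; rewrite ?hq.
Qed.

End cells.

Lemma sum_window_le (R : rcfType) (m j s : nat) (c : R) : 0 <= c ->
  \sum_(i < m | (j <= i < j + s)%N) c <= s%:R * c.
Proof.
move=> c0; suff : \sum_(i < m | (j <= i < j + s)%N) c <= (minn (m - j) s)%:R * c.
  by move=> /le_trans; apply; rewrite ler_wpM2r// ler_nat geq_minr.
elim: m => [|m IH]; first by rewrite big_ord0 mulr_ge0.
rewrite big_mkcond big_ord_recr -big_mkcond/=.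
case: ifP => hm; last first.
  by rewrite addr0; apply: le_trans IH _; rewrite ler_wpM2r// ler_nat; lia.
have -> : minn (m.+1 - j) s = (minn (m - j) s).+1 by lia.
by rewrite -natr1 mulrDl mul1r lerD2r.
Qed.

Section noise_control.
Variables (R : rcfType) (m kap T : nat) (X : nat -> R) (g1 g2 : R).
Hypothesis mT : (m < 2 ^ T)%N.
Hypothesis g1_gt0 : 0 < g1.
Hypothesis gap : forall i, (i.+1 < m)%N -> g1 <= X i.+1 - X i <= g2.

Local Notation cell := (@cell m kap T mT).
Local Notation label := (cell_label kap T).
Local Notation lev := (blevel m).

Definition hinge (j i : nat) : R := if (j < i)%N then X i - X j else 0.

(** Bound on the Euclidean norm of the hinge at [j] on its cell: with cell length [s], at most [s]
    entries of size at most [s * g2] give [g2 * s^(3/2)]. *)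
Definition cell_norm (j : nat) : R :=
  g2 * Num.sqrt (2 ^ (lev j - kap))%:R ^+ 3.

Lemma hinge_cell_norm (j : 'I_m) :
  \sum_(i < m | cell i == cell j) hinge j i ^+ 2 <= cell_norm j ^+ 2.
Proof.
set s := (2 ^ (lev j - kap))%N.
apply: (@le_trans _ _ (\sum_(i < m | (j <= i < j + s)%N) (s%:R * g2) ^+ 2)).
  rewrite [leLHS]big_mkcond [leRHS]big_mkcond; apply: ler_sum => i _.
  case: ifP => hc; last by case: ifP => // _; exact: sqr_ge0.
  rewrite /hinge; case: ifP => ji; last first.
    by rewrite expr0n/=; case: ifP => // _; exact: sqr_ge0.
  have := cell_width (esym (eqP hc)) ji.
  have /cell_eqP[_ hb _] := hc; rewrite hb -/s => w.
  rewrite w ltnW//=.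
  have /andP[h1 h2] := gap_ge gap (ltnW ji) (ltn_ord i).
  have sj : (i - j)%:R <= s%:R :> R by rewrite ler_nat; lia.
  have i0 : 0 <= (i - j)%:R :> R by [].
  have i1 : 0 < (i - j)%:R :> R by rewrite ltr0n subn_gt0.
  have g20 : 0 <= g2.
    rewrite -(pmulr_rge0 _ i1); apply: le_trans h2; apply: le_trans h1.
    by rewrite mulr_ge0// ltW.
  have X0 : 0 <= X i - X j by rewrite ltW// (X_lt g1_gt0 gap).
  rewrite ler_sqr ?nnegrE ?mulr_ge0//.
  by apply: le_trans h2 _; rewrite ler_wpM2r.
apply: le_trans (sum_window_le _ _ _ (sqr_ge0 _)) _.
have sq3 : (Num.sqrt s%:R ^+ 3) ^+ 2 = s%:R ^+ 3 :> R.
  by rewrite -exprM mulnC exprM sqr_sqrtr.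
rewrite /cell_norm -/s [leRHS]exprMn sq3.
by rewrite le_eqVlt; apply/orP; left; apply/eqP; ring.
Qed.

(** Cells are intervals, so a cell that does not contain [j] lies on one side of it. *)
Lemma hinge_affine (j : 'I_m) (l : label) : l != cell j ->
  exists a b : R, forall i : 'I_m, cell i == l -> hinge j i = a * X i + b.
Proof.
move=> lj.
have [/existsP[k /andP[/eqP kl jk]]|/existsPn none] :=
    boolP [exists k : 'I_m, (cell k == l) && (j < k)%N].
  exists 1, (- X j) => i /eqP il; rewrite /hinge mul1r.
  have [//|ij] := ltnP j i.
  have ineq : (i != j :> nat).
    by apply: contraNneq lj => /val_inj <-; rewrite il.
  case/eqP: lj; rewrite -il; apply/esym; apply: (@cell_interval _ _ _ _ i j k).
    by rewrite il kl.
  by rewrite jk andbT ltn_neqAle ineq.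
exists 0, 0 => i il; rewrite /hinge mul0r addr0.
by have := none i; rewrite il/= => /negbTE ->.
Qed.

Lemma hinge_small_cell (j i : 'I_m) : (lev j <= kap)%N -> cell i == cell j ->
  hinge j i = 0.
Proof.
clear g1_gt0 gap; move=> jk ij; rewrite /hinge; case: ifP => // ji.
have := cell_width (esym (eqP ij)) ji.
by have /cell_eqP[_ -> _] := ij; move: jk; rewrite -subn_eq0 => /eqP ->; lia.
Qed.

Hypothesis kap_gt0 : (0 < kap)%N.

(** With [h = 2^(t-2)], [sum_kink_annulus] bounds the kinks at distance at least [2^t] by
    [2 / (g1 h^(3/2))] times the norm on level [t - 1]. The cell norm on level [t] is
    [8 g2 h^(3/2) / 2^(3 kap / 2)], so [h] cancels and [16] is left. *)
Lemma sum_kink_level th t : convex_seq m X th -> (kap < t)%N ->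
  0 <= g2 ->
  \sum_(j < m | [&& 0 < j, j.+1 < m & lev j == t]%N) kink X th j * cell_norm j <=
  16 * (g2 / g1) / Num.sqrt (2 ^ kap)%:R ^+ 3 *
  Num.sqrt (\sum_(i < m | lev i == t.-1) th i ^+ 2).
Proof.
move=> cv kt g20.
have [t' tE] : exists t', t = t'.+2 by exists (t - 2)%N; lia.
pose h := (2 ^ t')%N.
have h0 : (0 < h)%N by rewrite expn_gt0.
have h4 : (2 ^ t = 4 * h)%N by rewrite tE !expnS mulnA.
have h2 : (2 ^ t.-1 = 2 * h)%N by rewrite tE expnS.
set S := \sum_(i < m | _) th i ^+ 2.
have S0 : 0 <= S by apply: sumr_ge0 => i _; exact: sqr_ge0.
have := sum_kink_annulus g1_gt0 gap cv h0.
set W := \sum_(_ <= j < _) _.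
have -> : \sum_(i < m | (2 * h <= bdist m i < 4 * h)%N) th i ^+ 2 = S.
  apply: eq_bigl => i; rewrite -h2 -h4 -[t in (_ < 2 ^ t)%N]prednK; last by lia.
  apply/idP/eqP => [hi|<-]; first by rewrite /blevel; apply: trunc_log_eq.
  exact: (blevel_bounds (ltn_ord i)).
move=> WS.
have q0 : 0 < Num.sqrt (2 ^ kap)%:R :> R by rewrite sqrtr_gt0 ltr0n expn_gt0.
have sq2 k : Num.sqrt (2 ^ k)%:R ^+ 2 = (2 ^ k)%:R :> R by rewrite sqr_sqrtr.
have nrm (j : 'I_m) : lev j == t ->
    cell_norm j = g2 * (8 * Num.sqrt h%:R ^+ 3) / Num.sqrt (2 ^ kap)%:R ^+ 3.
  move=> /eqP jt; rewrite /cell_norm jt -mulrA; congr (_ * _).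
  apply: (canRL (mulfK _)); first by rewrite expf_neq0// gt_eqF.
  rewrite -exprMn -sqrtrM// -natrM -expnD subnK; last exact: ltnW.
  rewrite h4 natrM sqrtrM// exprMn; congr (_ * _).
  have -> : Num.sqrt 4%:R = 2 :> R.
    by rewrite -[4%:R](_ : 2 ^+ 2 = _) ?sqrtr_sqr ?ger0_norm//; ring.
  by ring.
apply: (@le_trans _ _
   (W * (g2 * (8 * Num.sqrt h%:R ^+ 3) / Num.sqrt (2 ^ kap)%:R ^+ 3))).
  rewrite (eq_bigr (fun j : 'I_m => kink X th j *
     (g2 * (8 * Num.sqrt h%:R ^+ 3) / Num.sqrt (2 ^ kap)%:R ^+ 3))); last first.
    by move=> j /and3P[_ _ /nrm ->].
  rewrite -mulr_suml; apply: ler_wpM2r.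
    by rewrite divr_ge0 ?mulr_ge0 ?exprn_ge0 ?sqrtr_ge0.
  have WE : W = \sum_(j < m | ((4 * h).-1 <= j < (m - 4 * h).+1)%N) kink X th j.
    have [m0|m0] := posnP m.
      rewrite /W big_geq; last by rewrite m0; lia.
      by rewrite big1// => j _; have := ltn_ord j; rewrite {2}m0.
    rewrite /W (big_nat_widen _ _ m); last by lia.
    rewrite (big_nat_widenl _ 0)// big_mkord; apply: eq_bigl => j.
    by rewrite andbC.
  (* [W] runs over all levels from [t] upwards; the surplus kinks are nonnegative. *)
  rewrite WE [leLHS]big_mkcond [leRHS]big_mkcond; apply: ler_sum => j _.
  case: ifP => [/and3P[j0 jm /eqP jt]|_].
    have := blevel_bounds (ltn_ord j); rewrite jt h4 => /andP[hj _].
    by case: ifP => //; move: hj; rewrite /bdist; lia.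
  case: ifP => // hj; apply: (kink_ge0 g1_gt0 gap cv); move: hj; lia.
have W' : W <= Num.sqrt (4 / (g1 ^+ 2 * h%:R ^+ 3) * S).
  by apply: le_trans (ler_norm _) _; rewrite -sqrtr_sqr ler_wsqrtr.
have -> : 16 * (g2 / g1) / Num.sqrt (2 ^ kap)%:R ^+ 3 * Num.sqrt S =
    (2 / (g1 * Num.sqrt h%:R ^+ 3)) * Num.sqrt S *
     (g2 * (8 * Num.sqrt h%:R ^+ 3) / Num.sqrt (2 ^ kap)%:R ^+ 3).
  field.
  by rewrite !gt_eqF// sqrtr_gt0 ltr0n.
apply: ler_wpM2r; first by rewrite divr_ge0 ?mulr_ge0 ?exprn_ge0 ?sqrtr_ge0.
apply: le_trans W' _; rewrite sqrtrM; last first.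
  by rewrite divr_ge0// mulr_ge0 ?exprn_ge0// ltW.
apply: ler_wpM2r; first exact: sqrtr_ge0.
rewrite -[leRHS]ger0_norm -?sqrtr_sqr; last first.
  by rewrite divr_ge0// mulr_ge0 ?exprn_ge0 ?sqrtr_ge0// ltW.
rewrite ler_wsqrtr// expr_div_n exprMn -exprM mulnC exprM sqr_sqrtr//.
by rewrite le_eqVlt; apply/orP; left; apply/eqP; congr (_ / _); ring.
Qed.

Lemma sum_shift_le (S : nat -> R) : (forall t, 0 <= S t) ->
  \sum_(t < T | (kap < t)%N) S t.-1 <= \sum_(t < T) S t.
Proof.
move=> S0; case: T => [|T']; first by rewrite !big_ord0.
rewrite big_mkcond big_ord_recl/= add0r big_ord_recr/= ler_wpDr//.
by apply: ler_sum => t _; case: ifP.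
Qed.

(** Cauchy-Schwarz over the at most [T] levels: each level is charged to the annulus just outside
    it, and the squared norms on distinct annuli add up. *)
Lemma sum_kink_cell_norm th : convex_seq m X th -> 0 <= g2 ->
  \sum_(j < m | [&& 0 < j, j.+1 < m & kap < lev j]%N) kink X th j * cell_norm j <=
  16 * (g2 / g1) / Num.sqrt (2 ^ kap)%:R ^+ 3 *
  (Num.sqrt T%:R * Num.sqrt (\sum_(i < m) th i ^+ 2)).
Proof.
move=> cv g20.
pose lev' (j : 'I_m) := Ordinal (blevel_lt mT (ltn_ord j)).
pose S t := \sum_(i < m | lev i == t) th i ^+ 2.
have S0 t : 0 <= S t by apply: sumr_ge0 => i _; exact: sqr_ge0.
rewrite (partition_big lev' (fun t => (kap < t)%N)) => [|j /and3P[]//].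
apply: (@le_trans _ _ (\sum_(t < T | (kap < t)%N)
    16 * (g2 / g1) / Num.sqrt (2 ^ kap)%:R ^+ 3 * Num.sqrt (S t.-1))).
  apply: ler_sum => t kt; apply: le_trans (sum_kink_level cv kt g20).
  rewrite le_eqVlt; apply/orP; left; apply/eqP; apply: eq_bigl => j.
  by rewrite -val_eqE/= -!andbA; case: eqP => [->|_]; rewrite ?kt ?andbF.
rewrite -mulr_sumr; apply: ler_wpM2l.
  by rewrite divr_ge0 ?exprn_ge0 ?sqrtr_ge0// mulr_ge0// divr_ge0// ltW.
rewrite (eq_bigr (fun t : 'I_T => 1 * Num.sqrt (S t.-1))) => [|t _];
  last by rewrite mul1r.
apply: le_trans (sum_mul_le_sqrt _ _ _) _.
apply: ler_pM; rewrite ?sqrtr_ge0// ler_wsqrtr//.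
  rewrite big_mkcond/=; apply: (@le_trans _ _ (\sum_(t < T) 1)).
    by apply: ler_sum => t _; case: ifP; rewrite ?expr1n.
  by rewrite sumr_const card_ord.
rewrite (eq_bigr (fun t : 'I_T => S t.-1)) => [|t _]; last by rewrite sqr_sqrtr.
apply: le_trans (sum_shift_le S0) _.
by rewrite [leRHS](partition_big lev' xpredT).
Qed.

End noise_control.

(** [v] collects the affine frames of all cells; [u] has, for each [j], the normalised hinge at [j]
    on its cell and the two frame vectors of that cell. Both are chosen before [x], so [N] may
    depend on the noise. The constant is [48 = 3 * 16], with three forms per hinge and [16] from
    [sum_kink_level]. *)
Lemma convex_noise_control (R : rcfType) (m kap T : nat) (X : nat -> R)
    (g1 g2 : R) :
  (m < 2 ^ T)%N -> (0 < kap)%N -> 0 < g1 -> 0 < g2 ->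
  (forall i, (i.+1 < m)%N -> g1 <= X i.+1 - X i <= g2) ->
  exists (v : bool * cell_label kap T -> nat -> R)
         (u : option bool * 'I_m -> nat -> R),
    [/\ forall k, \sum_(i < m) v k i ^+ 2 <= 1,
        forall k, \sum_(i < m) u k i ^+ 2 <= 1 &
    forall (x : nat -> R) (N : R) (th1 th2 : nat -> R),
      (forall k, (\sum_(i < m) u k i * x i) ^+ 2 <= N) ->
      convex_seq m X th1 -> convex_seq m X th2 ->
      \sum_(i < m) x i * (th1 i - th2 i) <=
      Num.sqrt (\sum_k (\sum_(i < m) v k i * x i) ^+ 2) *
        Num.sqrt (\sum_(i < m) (th1 i - th2 i) ^+ 2) +
      48 * (g2 / g1) * Num.sqrt T%:R / Num.sqrt (2 ^ kap)%:R ^+ 3 * Num.sqrt N *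
        (Num.sqrt (\sum_(i < m) th1 i ^+ 2) +
         Num.sqrt (\sum_(i < m) th2 i ^+ 2))].
Proof.
move=> mT kap0 g1_gt0 g2_gt0 gap.
pose cell := @cell m kap T mT.
have [e1 [e2 frame]] : exists e1 e2 : cell_label kap T -> nat -> R, forall l,
    (forall u : nat -> R,
      (\sum_(i < m) u i * e1 l i) ^+ 2 + (\sum_(i < m) u i * e2 l i) ^+ 2 <=
      \sum_(i < m | cell i == l) u i ^+ 2) /\
    (forall (x u : nat -> R) (a b : R),
      (forall i : 'I_m, cell i == l -> u i = a * X i + b) ->
      \sum_(i < m | cell i == l) x i * u i =
      (\sum_(i < m) x i * e1 l i) * (\sum_(i < m) u i * e1 l i) +
      (\sum_(i < m) x i * e2 l i) * (\sum_(i < m) u i * e2 l i)).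
  have /fin_all_exists[e1 /fin_all_exists[e2 H]] :=
    fun l => affine_frame (fun i => cell i == l) X.
  by exists e1, e2.
have bessel l u := (frame l).1 u; have repro l := (frame l).2.
have norm1 l : \sum_(i < m) e1 l i ^+ 2 <= 1 /\ \sum_(i < m) e2 l i ^+ 2 <= 1.
  (* Bessel's inequality for a frame vector itself gives [s ^+ 2 <= s]. *)
  have aux (e : nat -> R) :
      (\sum_(i < m) e i * e i) ^+ 2 <= \sum_(i < m | cell i == l) e i ^+ 2 ->
      \sum_(i < m) e i ^+ 2 <= 1.
    set s := \sum_(i < m) e i ^+ 2 => h.
    have : \sum_(i < m | cell i == l) e i ^+ 2 <= s.
      rewrite big_mkcond; apply: ler_sum => i _; case: ifP => // _.
      exact: sqr_ge0.
    move=> /(le_trans h); have := sqr_ge0 (s - 1); nra.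
  split; apply: aux; apply: le_trans (bessel l _).
    by rewrite lerDl sqr_ge0.
  by rewrite lerDr sqr_ge0.
pose v (k : bool * cell_label kap T) := if k.1 then e1 k.2 else e2 k.2.
pose hin (j : 'I_m) (i : nat) : R :=
  if insub i is Some i' then
    if cell i' == cell j then hinge X j i / cell_norm m kap g2 j else 0
  else 0.
pose u (k : option bool * 'I_m) := match k.1 with
  | None => hin k.2
  | Some b => v (b, cell k.2) end.
have cn_gt0 j : 0 < cell_norm m kap g2 j.
  by rewrite mulr_gt0// exprn_gt0// sqrtr_gt0 ltr0n expn_gt0.
have v1 k : \sum_(i < m) v k i ^+ 2 <= 1.
  by case: k => -[] l; have [] := norm1 l.
exists v, u; split=> //.
  move=> [[b|] j]; first exact: v1.
  rewrite /u /= /hin.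
  have := hinge_cell_norm kap mT g1_gt0 gap j.
  rewrite -[leRHS]mul1r -ler_pdivrMr ?exprn_gt0// mulr_suml => /(le_trans _); apply.
  rewrite [leRHS]big_mkcond/=; apply: ler_sum => i _; rewrite valK.
  by rewrite -/(cell i) -/(cell j); case: ifP; rewrite ?expr_div_n// expr0n.
move=> x N th1 th2 uN cv1 cv2.
have sumv (F : bool * cell_label kap T -> R) :
    \sum_k F k = \sum_l (F (true, l) + F (false, l)).
  transitivity (\sum_(b : bool) \sum_l F (b, l)).
    by rewrite pair_bigA/=; apply: eq_bigr => -[].
  by rewrite big_bool/= big_split/= addrC.
have besselT (w : nat -> R) :
    \sum_k (\sum_(i < m) w i * v k i) ^+ 2 <= \sum_(i < m) w i ^+ 2.
  rewrite sumv [leRHS](partition_big cell xpredT)//=.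
  by apply: ler_sum => l _; exact: bessel.
(* [r] is [x] minus its projection on the frames, and [res l w] is the contribution of the cell [l]
   to the product of [r] and [w]; it vanishes if [w] is affine on [l]. *)
pose r (i : nat) := x i - \sum_k (\sum_(i' < m) x i' * v k i') * v k i.
pose res l (w : nat -> R) := \sum_(i < m | cell i == l) x i * w i -
  ((\sum_(i < m) x i * e1 l i) * (\sum_(i < m) w i * e1 l i) +
   (\sum_(i < m) x i * e2 l i) * (\sum_(i < m) w i * e2 l i)).
have rE (w : nat -> R) : \sum_(i < m) r i * w i = \sum_(i < m) x i * w i -
    \sum_k (\sum_(i < m) x i * v k i) * (\sum_(i < m) w i * v k i).
  under eq_bigr do rewrite /r mulrBl.
  rewrite sumrB; congr (_ - _).
  under eq_bigr do rewrite mulr_suml.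
  rewrite exchange_big/=; apply: eq_bigr => k _.
  by rewrite mulr_sumr; apply: eq_bigr => i _; ring.
have rres (w : nat -> R) : \sum_(i < m) r i * w i = \sum_l res l w.
  rewrite rE sumv /res sumrB; congr (_ - _).
  by rewrite (partition_big cell xpredT).
have N0 (j : 'I_m) : 0 <= N by apply: le_trans (uN (None, j)); exact: sqr_ge0.
have absu k : `|\sum_(i < m) u k i * x i| <= Num.sqrt N.
  rewrite -sqrtr_sqr ler_wsqrtr//.
(* Only the cell of [j] contributes: once through the hinge and twice through the frame, whence the
   factor [3]. *)
have res_hinge (j : 'I_m) : `|\sum_(i < m) r i * hinge X j i| <=
    if (kap < blevel m j)%N then 3 * Num.sqrt N * cell_norm m kap g2 j else 0.
  rewrite rres (bigD1 (cell j))//= big1 ?addr0; last first.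
    move=> l lj; have [a [b ab]] := hinge_affine X lj.
    by rewrite /res (repro l x (hinge X j) a b ab) subrr.
  case: ltnP => hk; last first.
    rewrite /res (repro (cell j) x (hinge X j) 0 0) ?subrr ?normr0// => i ij.
    by rewrite mul0r addr0 (hinge_small_cell X hk ij).
  set c := cell_norm _ _ _ _; have c0 : 0 < c := cn_gt0 j.
  have hb : \sum_(i < m | cell i == cell j) hinge X j i ^+ 2 <= c ^+ 2.
    exact: (hinge_cell_norm kap mT g1_gt0 gap j).
  have B1 := le_trans (bessel (cell j) (hinge X j)) hb.
  have sq1 (y z : R) : y ^+ 2 + z ^+ 2 <= c ^+ 2 -> `|y| <= c /\ `|z| <= c.
    move=> h; have y2 := sqr_ge0 y; have z2 := sqr_ge0 z.
    have c0' := ltW c0.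
    split; rewrite -ler_sqr ?nnegrE// real_normK ?num_real//;
      by apply: le_trans h; rewrite ?lerDl ?lerDr.
  have [b1 b2] := sq1 _ _ B1.
  have a0 : `|\sum_(i < m | cell i == cell j) x i * hinge X j i| <= Num.sqrt N * c.
    have := absu (None, j); rewrite -ler_pdivrMr// => h; apply: le_trans h.
    rewrite -[c^-1](gtr0_norm) ?invr_gt0// -normrM le_eqVlt; apply/orP; left.
    apply/eqP; congr `|_|; rewrite mulr_suml big_mkcond.
    apply: eq_bigr => i _; rewrite /u/= /hin valK.
    by case: ifP => _; rewrite ?mul0r//; rewrite /c; ring.
  have a12 b : `|\sum_(i < m) x i * v (b, cell j) i| <= Num.sqrt N.
    by have := absu (Some b, j); under eq_bigr do rewrite mulrC.
  rewrite /res; apply: le_trans (ler_normB _ _) _.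
  have n1 := ler_pM (normr_ge0 _) (normr_ge0 _) (a12 true) b1.
  have n2 := ler_pM (normr_ge0 _) (normr_ge0 _) (a12 false) b2.
  rewrite -!normrM in n1 n2.
  apply: le_trans (lerD (lexx _) (ler_normD _ _)) _.
  have -> : 3 * Num.sqrt N * c = Num.sqrt N * c + (Num.sqrt N * c + Num.sqrt N * c).
    by ring.
  by apply: lerD => //; apply: lerD.
pose C := 16 * (g2 / g1) / Num.sqrt (2 ^ kap)%:R ^+ 3.
have res_convex th : convex_seq m X th -> `|\sum_(i < m) r i * th i| <=
    3 * Num.sqrt N * (C * (Num.sqrt T%:R * Num.sqrt (\sum_(i < m) th i ^+ 2))).
  move=> cv.
  (* [r] annihilates affine vectors, so only the kinks of [kink_expansion] survive. *)
  have thE : \sum_(i < m) r i * th i =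
      \sum_(j < m | [&& 0 < j & j.+1 < m]%N) kink X th j *
         \sum_(i < m) r i * hinge X j i.
    pose a := slope X th 0 1; pose b := th 0%N - a * X 0%N.
    have aff : \sum_(i < m) r i * (a * X i + b) = 0.
      rewrite (rres (fun i => a * X i + b)) big1// => l _.
      by rewrite /res (repro l x (fun i => a * X i + b) a b) ?subrr.
    rewrite -[LHS]subr0 -[X in _ - X = _]aff -sumrB.
    under eq_bigr => i _ do rewrite -mulrBr.
    under [RHS]eq_bigr do rewrite mulr_sumr.
    rewrite exchange_big/=; apply: eq_bigr => i _.
    under [RHS]eq_bigr do rewrite mulrCA.
    rewrite -mulr_sumr; congr (_ * _).
    rewrite (kink_expansion g1_gt0 gap th (ltn_ord i)).
    rewrite (big_nat_widen _ _ m); last exact: ltnW.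
    rewrite (big_nat_widenl _ 0)// big_mkord/=.
    rewrite [X in _ + X - _]big_mkcond [RHS]big_mkcond/=.
    rewrite -/a /b addrAC.
    set S1 := \sum_(j < m) _; set S2 := \sum_(j < m) _.
    have -> : S1 = S2.
      apply: eq_bigr => j _; rewrite /hinge; have := ltn_ord i.
      case: (ltnP j i) => ji im; last by rewrite mulr0 !if_same.
      by rewrite (leq_ltn_trans ji im) andbT.
    ring.
  rewrite thE; apply: le_trans (ler_norm_sum _ _ _) _.
  apply: (@le_trans _ _ (3 * Num.sqrt N * \sum_(j < m | [&& 0 < j, j.+1 < m &
      kap < blevel m j]%N) kink X th j * cell_norm m kap g2 j)).
    rewrite mulr_sumr big_mkcond [leRHS]big_mkcond; apply: ler_sum => j _.
    have [/andP[j0 jm]|h] := boolP ((0 < j)%N && (j.+1 < m)%N); last first.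
      by rewrite andbA (negbTE h).
    have k0 := kink_ge0 g1_gt0 gap cv j0 jm.
    rewrite j0 jm/= normrM (ger0_norm k0).
    apply: le_trans (ler_wpM2l k0 (res_hinge j)) _.
    by case: ifP => _; rewrite ?mulr0// mulrCA.
  apply: ler_wpM2l; first by rewrite mulr_ge0// sqrtr_ge0.
  exact: (sum_kink_cell_norm mT g1_gt0 gap kap0 cv (ltW g2_gt0)).
have -> : \sum_(i < m) x i * (th1 i - th2 i) =
    \sum_k (\sum_(i < m) x i * v k i) * (\sum_(i < m) (th1 i - th2 i) * v k i) +
    \sum_(i < m) r i * (th1 i - th2 i).
  by rewrite (rE (fun i => th1 i - th2 i)) addrC subrK.
apply: lerD.
  apply: le_trans (sum_mul_le_sqrt _ _ _) _.
  have -> : \sum_k (\sum_(i < m) x i * v k i) ^+ 2 =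
      \sum_k (\sum_(i < m) v k i * x i) ^+ 2.
    by apply: eq_bigr => k _; congr (_ ^+ 2); apply: eq_bigr => i _; rewrite mulrC.
  rewrite ler_wpM2l ?sqrtr_ge0// ler_wsqrtr//.
  exact: (besselT (fun i => th1 i - th2 i)).
under eq_bigr do rewrite mulrBr.
rewrite sumrB; apply: le_trans (ler_norm _) _; apply: le_trans (ler_normB _ _) _.
apply: le_trans (lerD (res_convex _ cv1) (res_convex _ cv2)) _.
by rewrite le_eqVlt; apply/orP; left; apply/eqP; rewrite /C; ring.
Qed.

(** * Windows of the design *)

Lemma sum_blocks (R : rcfType) (b : nat -> nat) (k : nat) (F : nat -> R) :
  b 0%N = 0%N -> (forall p, (p < k)%N -> (b p <= b p.+1)%N) ->
  \sum_(i < b k) F i = \sum_(p < k) \sum_(i < b p.+1 - b p) F (b p + i)%N.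
Proof.
move=> b0; elim: k => [|k IH] bk; first by rewrite b0 !big_ord0.
rewrite big_ord_recr/= -IH => [|p pk]; last by rewrite bk// ltnS ltnW.
have [e ->] : exists e, b k.+1 = (b k + e)%N.
  by exists (b k.+1 - b k)%N; rewrite subnKC ?bk.
by rewrite addKn big_split_ord.
Qed.

Definition shift_vec (R : rcfType) (a m : nat) (w : nat -> R) (i : nat) : R :=
  if (a <= i < a + m)%N then w (i - a)%N else 0.

Lemma sum_shift_vec (R : rcfType) (n a m : nat) (w : nat -> R)
    (F : R -> nat -> R) : (a + m <= n)%N -> (forall i, F 0 i = 0) ->
  \sum_(i < n) F (shift_vec a m w i) i = \sum_(i < m) F (w i) (a + i)%N.
Proof.
move=> amn F0; rewrite -(subnKC amn) big_split_ord/= big_split_ord/=.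
rewrite big1 ?add0r => [|i _]; last first.
  by rewrite /shift_vec; case: ifP => //; have := ltn_ord i; lia.
rewrite [X in _ + X]big1 ?addr0 => [|i _]; last first.
  by rewrite /shift_vec; case: ifP => //; have := ltn_ord i; lia.
apply: eq_bigr => i _; rewrite /shift_vec leq_addr ltn_add2l ltn_ord/=.
by rewrite addKn.
Qed.

(** Extension by zero from the window. [u] is indexed by the position in the whole design, so that
    disjoint windows can share one family of [3 n] forms for the maximum. *)
Lemma convex_noise_control_window (R : rcfType) (n a m kap T : nat)
    (X : nat -> R) (g1 g2 : R) :
  (a + m <= n)%N -> (n < 2 ^ T)%N -> (0 < kap)%N -> 0 < g1 -> 0 < g2 ->
  (forall i, (i.+1 < n)%N -> g1 <= X i.+1 - X i <= g2) ->
  exists (v : bool * cell_label kap T -> nat -> R)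
         (u : option bool -> nat -> nat -> R),
    [/\ forall k, \sum_(i < n) v k i ^+ 2 <= 1,
        forall o j, \sum_(i < n) u o j i ^+ 2 <= 1 &
    forall (x : nat -> R) (N : R) (th1 th2 : nat -> R),
      (forall o j, (a <= j < a + m)%N ->
         (\sum_(i < n) u o j i * x i) ^+ 2 <= N) ->
      convex_seq m (fun i => X (a + i)%N) (fun i => th1 (a + i)%N) ->
      convex_seq m (fun i => X (a + i)%N) (fun i => th2 (a + i)%N) ->
      \sum_(i < m) x (a + i)%N * (th1 (a + i)%N - th2 (a + i)%N) <=
      Num.sqrt (\sum_k (\sum_(i < n) v k i * x i) ^+ 2) *
        Num.sqrt (\sum_(i < m) (th1 (a + i)%N - th2 (a + i)%N) ^+ 2) +
      48 * (g2 / g1) * Num.sqrt T%:R / Num.sqrt (2 ^ kap)%:R ^+ 3 * Num.sqrt N *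
        (Num.sqrt (\sum_(i < m) th1 (a + i)%N ^+ 2) +
         Num.sqrt (\sum_(i < m) th2 (a + i)%N ^+ 2))].
Proof.
move=> amn nT kap0 g10 g20 gap.
have mT : (m < 2 ^ T)%N by apply: leq_ltn_trans nT; lia.
have gap' i : (i.+1 < m)%N -> g1 <= X (a + i.+1)%N - X (a + i)%N <= g2.
  by move=> im; rewrite addnS; apply: gap; lia.
have [v [u [v1 u1 H]]] := convex_noise_control mT kap0 g10 g20 gap'.
pose u' o j := if insub (j - a)%N is Some j' then u (o, j') else fun=> 0.
have sq (w : nat -> R) : \sum_(i < n) shift_vec a m w i ^+ 2 = \sum_(i < m) w i ^+ 2.
  by rewrite (sum_shift_vec w (F := fun y _ => y ^+ 2))// => i; rewrite expr0n.
have dot (w x : nat -> R) : \sum_(i < n) shift_vec a m w i * x i =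
    \sum_(i < m) w i * x (a + i)%N.
  by rewrite (sum_shift_vec w (F := fun y i => y * x i))// => i; rewrite mul0r.
exists (fun k => shift_vec a m (v k)), (fun o j => shift_vec a m (u' o j)); split.
- by move=> k; rewrite sq.
- move=> o j; rewrite sq /u'; case: insub => [j'|]; first exact: u1.
  by rewrite big1// => i _; rewrite expr0n.
- move=> x N th1 th2 uN cv1 cv2.
  have -> : \sum_k (\sum_(i < n) shift_vec a m (v k) i * x i) ^+ 2 =
      \sum_k (\sum_(i < m) v k i * x (a + i)%N) ^+ 2.
    by apply: eq_bigr => k _; rewrite dot.
  apply: (H (fun i => x (a + i)%N) N (fun i => th1 (a + i)%N)
    (fun i => th2 (a + i)%N)) => //; case=> o j.
  have := uN o (a + j)%N; rewrite dot /u' addKn valK; apply.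
  by rewrite leq_addr ltn_add2l ltn_ord.
Qed.

Lemma convex_seq_sub_affine (R : rcfType) (m : nat) (X th l : nat -> R) (a b : R) :
  (forall i, (i < m)%N -> l i = a * X i + b) -> convex_seq m X th ->
  convex_seq m X (fun i => th i - l i).
Proof.
move=> lE cv i j k ij jk km; have := cv i j k ij jk km.
have jm := ltn_trans jk km.
by rewrite (lE i (ltn_trans ij jm)) (lE j jm) (lE k km); lra.
Qed.

Lemma convex_seq0 (R : rcfType) (m : nat) (X : nat -> R) :
  convex_seq m X (fun=> 0).
Proof. by move=> i j k _ _ _; rewrite !subrr !mul0r. Qed.

(* The constants come from splitting each product by [2ab <= e a^2 + b^2/e]. *)
Lemma sqr_norm_le_of_self_bound (R : rcfType) (D2 Q N b Y s t1 t2 : R) :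
  0 <= D2 -> 0 <= Q -> 0 <= N -> 0 <= b -> 0 < s -> 0 <= t2 ->
  0 <= t1 -> Num.sqrt t1 <= Num.sqrt D2 + Num.sqrt t2 -> t2 <= Y ->
  D2 <= Num.sqrt Q * Num.sqrt D2 +
        b * Num.sqrt N * (Num.sqrt t1 + Num.sqrt t2) ->
  D2 <= 2 * s + 2 * Q + (2 * b ^+ 2 + 2 * b ^+ 2 * Y / s) * N.
Proof.
move=> D20 Q0 N0 b0 s0 t20 t10 tri tY.
have := sqr_sqrtr D20; have := sqr_sqrtr Q0; have := sqr_sqrtr N0.
have := sqr_sqrtr t20.
have := sqrtr_ge0 D2; have := sqrtr_ge0 Q; have := sqrtr_ge0 N.
have := sqrtr_ge0 t2.
move: (Num.sqrt D2) (Num.sqrt Q) (Num.sqrt N) (Num.sqrt t2) (Num.sqrt t1) tri.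
move=> d q nn y y1 tri y0 n0 q0 d0 ey en eq ed.
rewrite -ed -eq -en => h.
have bn0 : 0 <= b * nn by exact: mulr_ge0.
have h1 : b * nn * (y1 + y) <= b * nn * (d + 2 * y).
  by rewrite ler_wpM2l//; lra.
have h2 : 4 * (b * nn * y) <= 2 * (b ^+ 2 * Y / s) * nn ^+ 2 + 2 * s.
  have : b ^+ 2 * y ^+ 2 * nn ^+ 2 <= b ^+ 2 * Y * nn ^+ 2.
    by rewrite ler_wpM2r ?sqr_ge0// ler_wpM2l ?sqr_ge0// ey.
  have -> : 2 * (b ^+ 2 * Y / s) * nn ^+ 2 + 2 * s =
      2 * (b ^+ 2 * Y * nn ^+ 2 + s ^+ 2) / s by field; rewrite gt_eqF.
  rewrite ler_pdivlMr//; have := sqr_ge0 (b * y * nn - s); nra.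
have := sqr_ge0 (d - 2 * q); have := sqr_ge0 (d - 2 * (b * nn)).
nra.
Qed.

(** * Linear forms of Gaussian noise *)

Section nonneg_integral.
Import HBNNSimple.

(** Both integrals are suprema over the simple functions below the integrand, and those below [f]
    lie below [g]. *)
Lemma le_integral_nonneg (d : measure_display) (T : measurableType d)
    (R : realType) (mu : {measure set T -> \bar R}) (f g : T -> \bar R) :
  (forall x, 0 <= f x)%E -> (forall x, f x <= g x)%E ->
  (\int[mu]_x f x <= \int[mu]_x g x)%E.
Proof.
move=> f0 fg; have g0 x : (0 <= g x)%E by exact: le_trans (f0 x) (fg x).
rewrite !ge0_integralTE//; apply: ereal_sup_le => _ [h /= hf <-].
exists h => // x.
exact: le_trans (hf x) (fg x).
Qed.

(** Passage from indicators to nonnegative functions by simple functions and monotone convergence,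
    in a form that serves twice: with [Y] a density and [phi] the identity, and with [Y] a product
    of other factors and [nu] the law of [phi]. *)
Lemma integral_weighted_comp (d d' : measure_display) (T : measurableType d)
    (T' : measurableType d') (R : realType) (mu : {measure set T -> \bar R})
    (nu : {measure set T' -> \bar R}) (phi : T -> T') (Y : T -> R) (c : R)
    (f : T' -> R) :
  measurable_fun setT phi -> measurable_fun setT Y -> (forall x, 0 <= Y x) ->
  0 <= c -> measurable_fun setT f -> (forall y, 0 <= f y) ->
  (forall B, measurable B ->
    \int[mu]_x (Y x * \1_B (phi x))%:E = c%:E * nu B)%E ->
  (\int[mu]_x (Y x * f (phi x))%:E = c%:E * \int[nu]_y (f y)%:E)%E.
Proof.
move=> mphi mY Y0 c0 mf f0 H.
have mf' := (measurable_EFinP _ _).2 mf.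
pose g := nnsfun_approx measurableT mf'.
have f0' y : (0 <= (f y)%:E)%E by rewrite lee_fin.
have gcvg y : (EFin \o g ^~ y) @ \oo --> (f y)%:E.
  exact: (@cvg_nnsfun_approx _ _ _ _ measurableT _ mf' (fun x _ => f0' x) y Logic.I).
have gnd y : nondecreasing_seq (g ^~ y).
  by move=> a b ab; exact/lefP/nd_nnsfun_approx.
have simple (h : {nnsfun T' >-> R}) :
    (\int[mu]_x (Y x * h (phi x))%:E = c%:E * \int[nu]_y (h y)%:E)%E.
  have [s hE r0] : exists2 s : seq R,
      forall y, h y = \sum_(r <- s) r * \1_(h @^-1` [set r]) y &
      forall r, r \in s -> 0 <= r.
    exists (finmap.enum_fset (fset_set (range h))).
      by move=> y; rewrite {1}(fimfunE h) fsbig_finite.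
    by move=> r; rewrite in_fset_set// inE => -[y _ <-].
  have mB r : measurable (h @^-1` [set r]) by [].
  under eq_integral do rewrite hE mulr_sumr -sumEFin.
  under [in RHS]eq_integral do rewrite hE -sumEFin.
  have mI r : measurable_fun setT (fun y => \1_(h @^-1` [set r]) y : R).
    exact: measurable_indic.
  have p0 r y : 0 <= r * \1_(h @^-1` [set r]) y.
    by have := nnfun_muleindic_ge0 h r y; rewrite -EFinM lee_fin.
  rewrite !ge0_integral_sum//=; last 4 first.
  - by move=> r; apply/measurable_EFinP; exact: measurable_funM.
  - by move=> r y _; rewrite lee_fin.
  - move=> r; apply/measurable_EFinP; apply: measurable_funM => //.
    by apply: measurable_funM => //; exact: measurableT_comp (mI r) mphi.
  - by move=> r x _; rewrite lee_fin mulr_ge0.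
  rewrite ge0_sume_distrr; last first.
    by move=> r _; apply: integral_ge0 => y _; rewrite lee_fin.
  rewrite !big_seq; apply: eq_bigr => r /r0 rge0.
  rewrite (eq_integral (fun x =>
    r%:E * (Y x * \1_(h @^-1` [set r]) (phi x))%:E)%E); last first.
    by move=> x _; rewrite -EFinM mulrCA.
  rewrite ge0_integralZl//; last 2 first.
  - apply/measurable_EFinP; apply: measurable_funM => //.
    exact: measurableT_comp (mI r) mphi.
  - by move=> x _; rewrite lee_fin mulr_ge0.
  rewrite H//; under [in RHS]eq_integral do rewrite EFinM.
  rewrite ge0_integralZl//; last exact/measurable_EFinP.
  by rewrite integral_indic// setIT muleCA.
have -> : (\int[nu]_y (f y)%:E = limn (fun n => \int[nu]_y (g n y)%:E))%E.
  rewrite -monotone_convergence//.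
  - by apply: eq_integral => y _; apply/esym/cvg_lim => //; exact: gcvg.
  - by move=> n; apply/measurable_EFinP.
  - by move=> n y _; rewrite lee_fin.
  - by move=> y _ a b ab; rewrite lee_fin; exact: gnd.
have -> : (\int[mu]_x (Y x * f (phi x))%:E =
           limn (fun n => \int[mu]_x (Y x * g n (phi x))%:E))%E.
  rewrite -monotone_convergence//.
  - apply: eq_integral => x _; apply/esym/cvg_lim => //.
    under eq_fun do rewrite EFinM.
    by rewrite EFinM; apply: cvgeZl => //; exact: gcvg.
  - move=> n; apply/measurable_EFinP; apply: measurable_funM => //.
    exact: measurableT_comp.
  - by move=> n x _; rewrite lee_fin mulr_ge0.
  - by move=> x _ a b ab; rewrite lee_fin ler_wpM2l//; exact: gnd.
under eq_fun do rewrite simple.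
apply/cvg_lim => //; apply: cvgeZl => //.
apply: ereal_nondecreasing_is_cvgn => a b ab.
by apply: le_integral_nonneg => y; rewrite lee_fin//; exact: gnd.
Qed.

End nonneg_integral.

(** Completing the square: [expR (a * x)] turns the centred density into a multiple of the density
    with mean [a * s ^+ 2]. *)
Lemma integral_normal_expR (R : realType) (nu : {measure set R -> \bar R})
    (s a : R) : s != 0 ->
  (forall B, measurable B -> nu B = normal_prob 0 s B) ->
  (\int[nu]_x (expR (a * x))%:E =
   (expR (a ^+ 2 * s ^+ 2 / 2))%:E)%E.
Proof.
move=> s0 nuE.
have := @integral_weighted_comp _ _ _ _ R lebesgue_measure nu
  id (normal_pdf 0 s) 1 (fun x => expR (a * x)).
rewrite mul1e => <-//; last 4 first.
- exact: measurable_normal_pdf.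
- by move=> x; exact: normal_pdf_ge0.
- apply: measurableT_comp => //; exact: measurable_funM.
- move=> B mB; rewrite mul1e nuE// /normal_prob [RHS]integral_mkcond.
  apply: eq_integral => x _; rewrite patchE indicE.
  by case: (x \in B); rewrite ?mulr1 ?mulr0.
have shiftE x : normal_pdf 0 s x * expR (a * x) =
    expR (a ^+ 2 * s ^+ 2 / 2) * normal_pdf (a * s ^+ 2) s x.
  rewrite !normal_pdfE// /normal_fun -[LHS]mulrA [RHS]mulrCA -!expRD.
  by congr (_ * expR _); field.
transitivity (\int[lebesgue_measure]_x ((expR (a ^+ 2 * s ^+ 2 / 2))%:E *
    (normal_pdf (a * s ^+ 2) s x)%:E))%E.
  by apply: eq_integral => x _; rewrite shiftE.
rewrite ge0_integralZl//; last 2 first.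
- by apply/measurable_EFinP; exact: measurable_normal_pdf.
- by move=> x _; rewrite lee_fin normal_pdf_ge0.
by rewrite integral_normal_pdf mule1.
Qed.

(** Independence is given for events only. The factors pass from indicators to general functions one
    at a time: in [main] those from index [k] on are still indicators. *)
Lemma integral_prod_indep (R : realType) (d : measure_display)
    (T : measurableType d) (P : probability T R) (n : nat)
    (X : 'I_n -> {RV P >-> R}) (g : 'I_n -> R -> R) (m : 'I_n -> R) :
  mutually_independent X ->
  (forall i, measurable_fun setT (g i)) -> (forall i x, 0 <= g i x) ->
  (forall i, \int[P]_w (g i (X i w))%:E = (m i)%:E)%E ->
  (\int[P]_w (\prod_(i < n) g i (X i w))%:E = (\prod_(i < n) m i)%:E)%E.
Proof.
move=> indep mg g0 Eg.
have probE i B : measurable B ->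
    (\int[P]_w (\1_B (X i w))%:E = P (X i @^-1` B))%E.
  move=> mB; rewrite -[X i @^-1` B]setIT -integral_indic//.
  by rewrite -[_ @^-1` _]setTI; exact: measurable_funPT.
suff main k : (k <= n)%N -> forall (h : 'I_n -> R -> R) (c : 'I_n -> R),
    (forall i, measurable_fun setT (h i)) -> (forall i x, 0 <= h i x) ->
    (forall i, \int[P]_w (h i (X i w))%:E = (c i)%:E)%E ->
    (forall i : 'I_n, (k <= i)%N ->
       exists2 B, measurable B & h i = \1_B) ->
    (\int[P]_w (\prod_(i < n) h i (X i w))%:E = (\prod_(i < n) c i)%:E)%E.
  by apply: (main n) => // i; rewrite leqNgt ltn_ord.
elim: k => [_|k IH kn] h c mh h0 Eh hB.
  have [B mB hBE] : exists2 B : 'I_n -> set R,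
      (forall i, measurable (B i)) & forall i, h i = \1_(B i).
    have /choice[B HB] : forall i, exists B, measurable B /\ h i = \1_B.
      by move=> i; have [//|B mB ->] := hB i; exists B.
    by exists B => i; have [] := HB i.
  have -> : (\int[P]_w (\prod_(i < n) h i (X i w))%:E =
      P (\bigcap_(i in [set` [set: 'I_n]%SET]) (X i @^-1` B i)))%E.
    set A := \bigcap_(_ in _) _.
    have mA : measurable A.
      apply: fin_bigcap_measurable => // i _.
      by rewrite -[_ @^-1` _]setTI; exact: measurable_funPT.
    rewrite -[A]setIT -integral_indic//; apply: eq_integral => w _.
    congr (_%:E); rewrite indicE; have [wA|wA] := boolP (w \in A).
      rewrite big1// => i _; rewrite hBE indicE mem_set//.
      by move: wA; rewrite inE => /(_ i); apply; rewrite /= inE.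
    have [i wi] : exists i, ~ B i (X i w).
      apply/existsNP => wB; move: wA; rewrite notin_setE; apply => i _ /=.
      exact: wB.
    by rewrite (bigD1 i)//= hBE indicE memNset// mul0r.
  rewrite indep// -prodEFin; apply: eq_big => [i|i _]; first by rewrite inE.
  by rewrite -Eh hBE probE.
pose k' := Ordinal kn.
have cE i : c i = fine (\int[P]_w (h i (X i w))%:E) by rewrite Eh.
have c0 i : 0 <= c i.
  by rewrite cE fine_ge0// integral_ge0// => w _; rewrite lee_fin.
pose Y w := \prod_(i < n | i != k') h i (X i w).
have splitY w : (\prod_(i < n) h i (X i w)) = Y w * h k' (X k' w).
  by rewrite (bigD1 k')//= mulrC.
under eq_integral do rewrite splitY.
(* The factor at [k'] is freed, with [Y] the product of the others; for an indicator at [k'] the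
   identity is the induction hypothesis. *)
rewrite (@integral_weighted_comp _ _ _ _ _ P (distribution P (X k')) (X k') Y
  (\prod_(i < n | i != k') c i))//.
- rewrite ge0_integral_distribution//=; last 2 first.
  + exact/measurable_EFinP.
  + by move=> y; rewrite lee_fin.
  by rewrite Eh -EFinM [in RHS](bigD1 k')//= [in RHS]mulrC.
- rewrite /Y; under eq_fun do rewrite big_mkcond.
  by apply: measurable_prod => i _; case: (i != k') => //; exact: measurableT_comp.
- by move=> w; apply: prodr_ge0.
- by apply: prodr_ge0.
- move=> B mB.
  pose h' i := if i == k' then \1_B else h i.
  pose c' i := if i == k' then fine (distribution P (X k') B) else c i.
  have := IH (ltnW kn) h' c'.
  rewrite (bigD1 k')//= /c' eqxx EFinM fineK ?fin_num_measure// muleC.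
  rewrite (eq_bigr c); last by move=> i /negbTE ->.
  move=> <-.
  - apply: eq_integral => w _; rewrite (bigD1 k')//= /h' eqxx mulrC.
    by congr (_ * _)%:E; apply: eq_bigr => i /negbTE ->.
  - by move=> i; rewrite /h'; case: ifP => // _; exact: measurable_indic.
  - by move=> i x; rewrite /h'; case: ifP.
  - move=> i; rewrite /h' /c'; case: eqP => [->|_]; last exact: Eh.
    by rewrite probE// fineK// fin_num_measure.
  - move=> i; rewrite /h' leq_eqVlt; have [_ _|ik] := eqVneq i k'; first by exists B.
    by case/predU1P => [ki|/hB//]; case/eqP: ik; exact: val_inj.
Qed.

Lemma sqr_le_expR (R : realType) (y : R) : y ^+ 2 <= 4 * (expR y + expR (- y)).
Proof.
have key (u : R) : 0 <= u -> u ^+ 2 <= 4 * expR u.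
  move=> u0; have -> : expR u = expR (u / 2) ^+ 2.
    by rewrite expr2 -expRD; congr expR; lra.
  have := expR_ge1Dx (u / 2); nra.
have /orP[y0|y0] := le_total 0 y.
  by have := key _ y0; have := expR_ge0 (- y); lra.
by have := key (- y); rewrite sqrrN => /(_ ltac:(lra)); have := expR_ge0 y; lra.
Qed.

(** For [|y| <= 2 L] the first term suffices; beyond, [expR (|y| - L)] is at least [expR (|y| / 2)],
    hence at least [(1 + |y| / 4) ^+ 2]. The factor [expR (- L)] pays for the number of forms in a
    maximum. *)
Lemma sqr_le_shifted_expR (R : realType) (L y : R) : 0 <= L ->
  y ^+ 2 <= 4 * L ^+ 2 + 16 * expR (- L) * (expR y + expR (- y)).
Proof.
move=> L0.
have key (u : R) : 0 <= u -> u ^+ 2 <= 4 * L ^+ 2 + 16 * expR (- L) * expR u.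
  move=> u0; have e0 := mulr_ge0 (expR_ge0 (- L)) (expR_ge0 u).
  have [uL|uL] := leP u (2 * L); first by nra.
  rewrite -mulrA -expRD.
  have : expR (u / 2) <= expR (- L + u) by rewrite ler_expR; lra.
  have -> : expR (u / 2) = expR (u / 4) ^+ 2.
    by rewrite expr2 -expRD; congr expR; lra.
  have := expR_ge1Dx (u / 4); nra.
have e0 : 0 <= 16 * expR (- L) by rewrite mulr_ge0// expR_ge0.
have /orP[y0|y0] := le_total 0 y.
  by have := key _ y0; have := mulr_ge0 e0 (expR_ge0 (- y)); nra.
have := key (- y); rewrite sqrrN => /(_ ltac:(lra)).
by have := mulr_ge0 e0 (expR_ge0 y); nra.
Qed.

Lemma expR_half_le2 (R : realType) : expR (1 / 2) <= 2 :> R.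
Proof.
have := expR_ge1Dx (- (1 / 2) : R); rewrite expRN => h.
have e0 := expR_gt0 (1 / 2 : R).
have : expR (1 / 2) * (expR (1 / 2))^-1 = 1 :> R by rewrite divff// gt_eqF.
nra.
Qed.

Section gaussian_forms.
Variables (R : realType) (d : measure_display) (T : measurableType d).
Variables (P : probability T R) (n : nat) (sigma : R).
Variable (xi : 'I_n -> {RV P >-> R}).
Hypothesis sigma_gt0 : 0 < sigma.
Hypothesis xi_normal : iid_normal sigma xi.

Definition lin_form (v : nat -> R) (w : T) : R := \sum_(i < n) v i * xi i w.

Lemma measurable_lin_form v : measurable_fun setT (lin_form v).
Proof. by apply: measurable_sum => i; exact: measurable_funM. Qed.

Lemma integral_expR_lin_form v :
  (\int[P]_w (expR (lin_form v w))%:E =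
   (expR (sigma ^+ 2 / 2 * \sum_(i < n) v i ^+ 2))%:E)%E.
Proof.
have [indep law] := xi_normal.
rewrite mulr_sumr expR_sum.
under eq_integral do rewrite /lin_form expR_sum.
apply: (@integral_prod_indep _ _ _ _ _ _ (fun i x => expR (v i * x)) _ indep).
- move=> i; apply: measurableT_comp => //; exact: measurable_funM.
- by move=> i x; exact: expR_ge0.
move=> i.
have mexp : measurable_fun [set: R] (fun x : R => (expR (v i * x))%:E).
  by apply/measurable_EFinP; apply: measurableT_comp => //; exact: measurable_funM.
have := @ge0_integral_distribution _ _ _ _ _ P (xi i)
  (fun x : R => (expR (v i * x))%:E) mexp.
move=> /(_ (fun x => expR_ge0 _)) /= <-.
rewrite (@integral_normal_expR _ _ sigma) ?gt_eqF//; last exact: law.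
by congr (expR _)%:E; field.
Qed.

Lemma measurable_cosh_lin_form (t : R) v : measurable_fun setT
  (fun w => expR (t * lin_form v w) + expR (- (t * lin_form v w))).
Proof.
have m s : measurable_fun setT (fun w => expR (s * lin_form v w)).
  apply: measurableT_comp => //; apply: measurable_funM => //.
  exact: measurable_lin_form.
apply: measurable_funD; first exact: m.
by under eq_fun do rewrite -mulNr; exact: m.
Qed.

Lemma integral_cosh_lin_form (t : R) (v : nat -> R) :
  \sum_(i < n) v i ^+ 2 <= 1 ->
  (\int[P]_w (expR (t * lin_form v w) + expR (- (t * lin_form v w)))%:E <=
   (2 * expR (t ^+ 2 * sigma ^+ 2 / 2))%:E)%E.
Proof.
move=> v1.
have scale s w : s * lin_form v w = lin_form (fun i => s * v i) w.
  by rewrite /lin_form mulr_sumr; apply: eq_bigr => i _; rewrite mulrA.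
have bnd s : s ^+ 2 = t ^+ 2 ->
    (\int[P]_w (expR (s * lin_form v w))%:E <=
     (expR (t ^+ 2 * sigma ^+ 2 / 2))%:E)%E.
  move=> st; under eq_integral do rewrite scale.
  rewrite integral_expR_lin_form lee_fin ler_expR.
  under eq_bigr do rewrite exprMn st.
  rewrite -mulr_sumr.
  have := sqr_ge0 sigma; have := sqr_ge0 t; nra.
under eq_integral do rewrite EFinD -mulNr.
rewrite ge0_integralD//=; last 2 first.
- apply/measurable_EFinP; apply: measurableT_comp => //.
  by apply: measurable_funM => //; exact: measurable_lin_form.
- apply/measurable_EFinP; apply: measurableT_comp => //.
  by apply: measurable_funM => //; exact: measurable_lin_form.
rewrite mulrDl mul1r EFinD; apply: leeD; apply: bnd => //.
by rewrite sqrrN.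
Qed.

Lemma integral_sum_cosh (I : finType) (t : R) (v : I -> nat -> R) :
  (forall k, \sum_(i < n) v k i ^+ 2 <= 1) ->
  (\int[P]_w (\sum_k (expR (t * lin_form (v k) w) +
                      expR (- (t * lin_form (v k) w))))%:E <=
   (#|I|%:R * (2 * expR (t ^+ 2 * sigma ^+ 2 / 2)))%:E)%E.
Proof.
move=> v1; under eq_integral do rewrite -sumEFin.
rewrite ge0_integral_sum//; last first.
  by move=> k; apply/measurable_EFinP; exact: measurable_cosh_lin_form.
rewrite mulr_natl -[#|I|]/#|xpredT : pred I| -sumr_const -sumEFin.
by apply: lee_sum => k _; exact: integral_cosh_lin_form.
Qed.

(* [f] need not be measurable: it is dominated by a measurable function, and the
   integral of a nonnegative function is a supremum over simple functions. *)
Lemma expectation_le_quadratic (I J : finType) (v : I -> nat -> R)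
    (u : J -> nat -> R) (f : T -> R) (c0 A B L : R) :
  (forall k, \sum_(i < n) v k i ^+ 2 <= 1) ->
  (forall k, \sum_(i < n) u k i ^+ 2 <= 1) ->
  0 <= c0 -> 0 <= A -> 0 <= B -> 1 <= L -> #|J|%:R <= expR (L / 2) ->
  (forall w, 0 <= f w) ->
  (forall w N, (forall k, lin_form (u k) w ^+ 2 <= N) ->
     f w <= c0 + A * (\sum_k lin_form (v k) w ^+ 2) + B * N) ->
  (\int[P]_w (f w)%:E <=
   (c0 + 16 * A * sigma ^+ 2 * #|I|%:R + 36 * B * sigma ^+ 2 * L)%:E)%E.
Proof.
move=> v1 u1 c00 A0 B0 L1 JL f0 fle.
pose cosh (K : finType) (t : R) (z : K -> nat -> R) w :=
  \sum_k (expR (t * lin_form (z k) w) + expR (- (t * lin_form (z k) w))).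
(* Scaling by [t1] gives the moment [expR (1 / 2)], suited to a sum of squares; [t2] gives
   [expR (L / 2)], suited to a maximum over up to [expR (L / 2)] forms. *)
pose t1 := sigma^-1.
pose t2 := Num.sqrt L / sigma.
pose a1 := A * (4 * sigma ^+ 2).
pose a2 := B * (sigma ^+ 2 / L * (16 * expR (- L))).
pose a0 := c0 + B * (sigma ^+ 2 * (4 * L)).
have s0 : sigma != 0 by rewrite gt_eqF.
have L0 : 0 < L by exact: lt_le_trans ltr01 L1.
have s2 := sqr_ge0 sigma.
have cosh0 K t z w : 0 <= cosh K t z w.
  by apply: sumr_ge0 => k _; rewrite addr_ge0// expR_ge0.
have a1_ge0 : 0 <= a1 by rewrite /a1 mulr_ge0// mulr_ge0.
have a2_ge0 : 0 <= a2.
  by apply: mulr_ge0 => //; apply: mulr_ge0;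
    [apply: divr_ge0 => //; exact: ltW|apply: mulr_ge0 => //; exact: expR_ge0].
have a0_ge0 : 0 <= a0.
  by rewrite /a0 addr_ge0// mulr_ge0// mulr_ge0// mulr_ge0// ltW.
have fG w : f w <= a0 + a1 * cosh I t1 v w + a2 * cosh J t2 u w.
  (* The sum over all forms dominates each of them, so this value is admissible for [fle]. *)
  pose N := sigma ^+ 2 / L * (4 * L ^+ 2 + 16 * expR (- L) * cosh J t2 u w).
  have : forall k, lin_form (u k) w ^+ 2 <= N.
    move=> k; set z := lin_form (u k) w.
    have -> : z ^+ 2 = sigma ^+ 2 / L * (t2 * z) ^+ 2.
      rewrite /t2 !exprMn sqr_sqrtr ?ltW//; field.
      by rewrite s0 gt_eqF.
    rewrite ler_wpM2l//; first by rewrite divr_ge0// ltW.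
    apply: (le_trans (sqr_le_shifted_expR _ (ltW L0))).
    rewrite lerD2l ler_wpM2l ?mulr_ge0 ?expR_ge0// /cosh (bigD1 k)//= lerDl.
    by apply: sumr_ge0 => j _; rewrite addr_ge0// expR_ge0.
  move=> /fle /le_trans; apply.
  have : \sum_k lin_form (v k) w ^+ 2 <= 4 * sigma ^+ 2 * cosh I t1 v w.
    rewrite /cosh mulr_sumr; apply: ler_sum => k _.
    set z := lin_form (v k) w.
    have -> : z ^+ 2 = sigma ^+ 2 * (t1 * z) ^+ 2 by rewrite /t1; field.
    apply: le_trans (ler_wpM2l s2 (sqr_le_expR _)) _.
    by rewrite mulrCA mulrA.
  move=> /(ler_wpM2l A0) h.
  have -> : a0 = c0 + B * (sigma ^+ 2 / L * (4 * L ^+ 2)).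
    by rewrite /a0; congr (_ + _ * _); field; rewrite gt_eqF.
  rewrite /a1 /a2 /N; lra.
have mcosh K t z : measurable_fun setT (cosh K t z).
  by apply: measurable_sum => k; exact: measurable_cosh_lin_form.
apply: (@le_trans _ _ (\int[P]_w (a0%:E + a1%:E * (cosh I t1 v w)%:E +
    a2%:E * (cosh J t2 u w)%:E)))%E.
  apply: le_integral_nonneg => w; first by rewrite lee_fin.
  by rewrite -!EFinM -!EFinD lee_fin.
rewrite ge0_integralD//=; last 4 first.
- by move=> w _; rewrite -EFinM -EFinD lee_fin addr_ge0// mulr_ge0.
- apply/measurable_EFinP/measurable_funD => //; exact: measurable_funM.
- by move=> w _; rewrite -EFinM lee_fin mulr_ge0.
- apply/measurable_EFinP; exact: measurable_funM.
rewrite ge0_integralD//=; last 2 first.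
- by move=> w _; rewrite -EFinM lee_fin mulr_ge0.
- apply/measurable_EFinP; exact: measurable_funM.
rewrite integral_cst//= probability_setT mule1.
rewrite !ge0_integralZl//=; last 4 first.
- exact/measurable_EFinP.
- by move=> w _; rewrite lee_fin.
- exact/measurable_EFinP.
- by move=> w _; rewrite lee_fin.
have I1 := @integral_sum_cosh I t1 v v1.
have I2 := @integral_sum_cosh J t2 u u1.
have a1E : (0 <= a1%:E)%E by rewrite lee_fin.
have a2E : (0 <= a2%:E)%E by rewrite lee_fin.
apply: le_trans (leeD (leeD (lexx _) (lee_wpmul2l a1E I1))
  (lee_wpmul2l a2E I2)) _.
rewrite -!EFinM -!EFinD lee_fin.
have -> : t1 ^+ 2 * sigma ^+ 2 / 2 = 1 / 2 by rewrite /t1; field.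
have -> : t2 ^+ 2 * sigma ^+ 2 / 2 = L / 2.
  by rewrite /t2 exprMn sqr_sqrtr ?ltW//; field.
have i1 : a1 * (#|I|%:R * (2 * expR (1 / 2))) <=
    16 * A * sigma ^+ 2 * #|I|%:R.
  have -> : 16 * A * sigma ^+ 2 * #|I|%:R = a1 * (#|I|%:R * (2 * 2)).
    by rewrite /a1; ring.
  by rewrite !ler_wpM2l ?ler0n// expR_half_le2.
(* Here [#|J| * expR (- L) * expR (L / 2) <= 1]; the [32] joins the [4] in [a0] to make [36]. *)
have i2 : a2 * (#|J|%:R * (2 * expR (L / 2))) <= B * (sigma ^+ 2 / L * 32).
  have -> : a2 * (#|J|%:R * (2 * expR (L / 2))) =
      B * (sigma ^+ 2 / L * 32) * (#|J|%:R * (expR (- L) * expR (L / 2))).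
    by rewrite /a2; ring.
  rewrite -expRD -[leRHS]mulr1 ler_wpM2l//.
    apply: mulr_ge0 => //; apply: mulr_ge0 => //.
    by apply: divr_ge0 => //; exact: ltW.
  have -> : - L + L / 2 = - (L / 2) by lra.
  by rewrite expRN -ler_pdivlMr ?invr_gt0 ?expR_gt0// invrK mul1r.
have i3 : B * (sigma ^+ 2 / L * 32) <= B * (sigma ^+ 2 * 32 * L).
  rewrite ler_wpM2l// mulrAC; apply: ler_wpM2l; first exact: mulr_ge0.
  by apply: le_trans (_ : 1 <= L); rewrite ?invf_le1.
rewrite /a0; lra.
Qed.

End gaussian_forms.

(** * Convex least squares *)

Lemma convex01P (R : realType) (f : R -> R) : convex01 f <->
  forall t u w : R, 0 <= t <= 1 -> 0 <= u <= 1 -> 0 <= w <= 1 ->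
    f (t * u + (1 - t) * w) <= t * f u + (1 - t) * f w.
Proof.
split=> [cf t u w /andP[t0 t1] u01 w01|H t u w u01 w01].
  have := cf (Itv01 t0 t1) u w; rewrite !inE/= !in_itv/= => /(_ u01 w01).
  by rewrite !convRE.
move: u01 w01; rewrite !inE/= !in_itv/= => u01 w01.
rewrite !convRE; apply: (H t%:num u w) => //.
by apply/andP; split.
Qed.

Lemma convex01_three_points (R : realType) (f : R -> R) (u v w : R) :
  convex01 f -> 0 <= u -> u < v -> v < w -> w <= 1 ->
  (f v - f u) * (w - v) <= (f w - f v) * (v - u).
Proof.
move=> /convex01P cf u0 uv vw w1.
have wu : 0 < w - u by lra.
have := cf ((w - v) / (w - u)) u w.
have -> : (w - v) / (w - u) * u + (1 - (w - v) / (w - u)) * w = v.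
  by field; rewrite gt_eqF.
have -> : (w - v) / (w - u) * f u + (1 - (w - v) / (w - u)) * f w =
    ((w - v) * f u + (v - u) * f w) / (w - u).
  by field; rewrite gt_eqF.
move=> H; have {H} : f v <= ((w - v) * f u + (v - u) * f w) / (w - u).
  apply: H; [|lra|lra].
  by rewrite ler_pdivrMr// mul1r divr_ge0/=; lra.
by rewrite ler_pdivlMr// => ?; lra.
Qed.

(** First-order optimality of [g] along the segment from [g] to [psi], which consists of convex
    functions. *)
Lemma convex_lse_variational (R : realType) (n : nat) (x y : 'I_n -> R)
    (g psi : R -> R) : convex_lse x y g -> convex01 psi ->
  \sum_(i < n) (y i - g (x i)) * (psi (x i) - g (x i)) <= 0.
Proof.
move=> [/convex01P cg gmin] /convex01P cpsi.
set S := \sum_(i < n) _.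
pose D := \sum_(i < n) (psi (x i) - g (x i)) ^+ 2.
have D0 : 0 <= D by apply: sumr_ge0 => i _; exact: sqr_ge0.
have key t : 0 <= t <= 1 -> 2 * t * S <= t ^+ 2 * D.
  move=> t01.
  have /gmin : convex01 (fun z => t * psi z + (1 - t) * g z).
    apply/convex01P => s u w s01 u01 w01.
    have := cg s u w s01 u01 w01; have := cpsi s u w s01 u01 w01.
    by move: t01 => /andP[]; nra.
  have E : \sum_(i < n) (y i - (t * psi (x i) + (1 - t) * g (x i))) ^+ 2 =
      \sum_(i < n) (y i - g (x i)) ^+ 2 + (t ^+ 2 * D - 2 * t * S).
    rewrite /D /S !mulr_sumr -sumrB -big_split/=; apply: eq_bigr => i _; ring.
  by rewrite E lerDl subr_ge0.
rewrite leNgt; apply/negP => S0.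
(* [t = 1] gives [2 S <= D], so [t = S / D] is allowed, where the inequality forces
   [2 S ^+ 2 <= S ^+ 2]. *)
have h1 := key 1; have D1 : 2 * S <= D by have := h1 ltac:(lra); lra.
have D00 : 0 < D by lra.
have : 0 <= S / D <= 1.
  by rewrite divr_ge0 ?ler_pdivrMr ?mul1r//; lra.
move=> /key; have -> : (S / D) ^+ 2 * D = S ^+ 2 / D by field; rewrite gt_eqF.
rewrite ler_pdivlMr//.
have -> : 2 * (S / D) * S * D = 2 * S ^+ 2 by field; rewrite gt_eqF.
have : 0 < S ^+ 2 by rewrite exprn_gt0.
lra.
Qed.

(** Sum of two variational inequalities, [phi0] tested with [g] and [g] tested with [phi0]; [f0]
    cancels. *)
Lemma basic_inequality (R : realType) (n : nat) (x xi : 'I_n -> R)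
    (f0 phi0 g : R -> R) : convex_projection x f0 phi0 ->
  convex_lse x (fun i => f0 (x i) + xi i) g ->
  \sum_(i < n) (g (x i) - phi0 (x i)) ^+ 2 <=
  \sum_(i < n) xi i * (g (x i) - phi0 (x i)).
Proof.
move=> hp hg.
have h1 := convex_lse_variational hp hg.1.
have h2 := convex_lse_variational hg hp.1.
rewrite -subr_ge0 -sumrB.
have : 0 <= - (\sum_(i < n) (f0 (x i) - phi0 (x i)) * (g (x i) - phi0 (x i)) +
   \sum_(i < n) (f0 (x i) + xi i - g (x i)) * (phi0 (x i) - g (x i))) by lra.
rewrite -big_split -sumrN/=; congr (0 <= _); apply: eq_bigr => i _; ring.
Qed.

Definition nat_ext (R : realType) (n : nat) (F : 'I_n -> R) (k : nat) : R :=
  if insub k is Some i then F i else 0.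

Lemma nat_extE (R : realType) (n : nat) (F : 'I_n -> R) (i : 'I_n) :
  nat_ext F i = F i.
Proof. by rewrite /nat_ext valK. Qed.

Section design_points.
Variables (R : realType) (n : nat) (c1 c2 : R) (x : 'I_n -> R).
Hypothesis xdesign : design c1 c2 x.

Let X := nat_ext x.

Lemma design01 i : (i < n)%N -> 0 <= X i <= 1.
Proof.
by move=> im; have [h _ _] := xdesign; rewrite /X -[i]/(val (Ordinal im)) nat_extE.
Qed.

Lemma design_lt i j : (i < j)%N -> (j < n)%N -> X i < X j.
Proof.
move=> ij jn; have [_ h _] := xdesign.
rewrite /X -[i]/(val (Ordinal (ltn_trans ij jn))) -[j]/(val (Ordinal jn)) !nat_extE.
exact: h.
Qed.

Lemma design_gap i : (i.+1 < n)%N -> c1 / n%:R <= X i.+1 - X i <= c2 / n%:R.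
Proof.
move=> im; have [_ _ h] := xdesign.
have := h (Ordinal (ltnW im)) (Ordinal im) erefl.
rewrite -!nat_extE/= -/X; have n0 : 0 < n%:R :> R by rewrite ltr0n; lia.
by rewrite ler_pdivrMr// ler_pdivlMr// mulrC.
Qed.

Lemma convex01_seq f a m : convex01 f -> (a + m <= n)%N ->
  convex_seq m (fun i => X (a + i)%N) (fun i => f (X (a + i)%N)).
Proof.
move=> cf amn i j k ij jk km.
have /andP[h1 _] := @design01 (a + i) ltac:(lia).
have /andP[_ h2] := @design01 (a + k) ltac:(lia).
by apply: convex01_three_points => //; apply: design_lt; lia.
Qed.

(** The [n - 1] gaps fit into the unit interval. This serves to bound [c1] by [2]. *)
Lemma design_c1_le : (2 <= n)%N -> c1 * (n.-1)%:R <= n%:R.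
Proof.
move=> n_ge2.
have /andP[h _] := @gap_ge _ n X _ _ design_gap 0 n.-1 ltac:(lia) ltac:(lia).
have /andP[h1 _] := @design01 0 ltac:(lia).
have /andP[_ h2] := @design01 n.-1 ltac:(lia).
have : (n.-1)%:R * (c1 / n%:R) <= 1 by rewrite subn0 in h; lra.
by rewrite mulrA ler_pdivrMr ?mul1r ?ltr0n 1?mulrC//; lia.
Qed.

End design_points.

(** * Logarithmic factors and powers of two *)

Lemma ln2_bounds (R : realType) : 1 / 2 <= ln (2 : R) <= 7 / 9.
Proof.
have p2 : (2 : R) \is Num.pos by rewrite posrE.
apply/andP; split; rewrite -ler_expR lnK//; first exact: expR_half_le2.
(* [7 / 9] is exactly what [1 + ln n <= 8 * l] asks for at [n = 2], given
   [l >= 1 + ln n - 2 * ln 2]. *)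
have -> : expR (7 / 9) = expR (7 / 36) ^+ 4 :> R.
  by rewrite -expRM_natl; congr expR; lra.
have h := expR_ge1Dx (7 / 36 : R).
have : (1 + 7 / 36) ^+ 4 <= expR (7 / 36 : R) ^+ 4.
  by rewrite lerXn2r ?nnegrE ?expR_ge0//; lra.
by apply: le_trans; lra.
Qed.

(** As [c1 <= 2], [l] is at least [1 + ln n - 2 * ln 2], which is comparable with [1 + ln n]. The
    third bound counts the dyadic levels; the fourth admits a maximum over [3 n] forms with
    parameter [4 * (1 + ln n)]. *)
Lemma log_factor_bounds (R : realType) (n : nat) (c1 : R) :
  (2 <= n)%N -> 0 < c1 -> c1 * n.-1%:R <= n%:R ->
  let l := ln (expR 1 * n%:R / (2 * c1)) in
  [/\ 1 + ln n%:R <= 8 * l, 3 / 2 <= 1 + ln n%:R :> R,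
      ((trunc_log 2 n).+1)%:R <= 16 * l &
      (3 * n)%:R <= expR (4 * (1 + ln n%:R) / 2) :> R].
Proof.
move=> n2 c10 c1n l.
have /andP[l2a l2b] := ln2_bounds R.
have nn : 2 <= n%:R :> R by rewrite ler_nat.
have n0 : 0 < n%:R :> R by lra.
have lnn : ln 2 <= ln n%:R :> R by rewrite ler_ln ?posrE.
have c12 : c1 <= 2.
  have h : n.-1.+1 = n by lia.
  have e : n%:R = n.-1%:R + 1 :> R by rewrite -{1}h -natr1.
  by rewrite e in nn c1n; nra.
have lE : 1 + ln n%:R - 2 * ln 2 <= l.
  have -> : 1 + ln n%:R - 2 * ln 2 = ln (expR 1 * n%:R / (2 * 2)) :> R.
    rewrite ln_div ?posrE ?mulr_gt0 ?expR_gt0// lnM ?posrE ?expR_gt0//.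
    by rewrite expRK lnM ?posrE//; lra.
  rewrite ler_ln ?posrE ?divr_gt0 ?mulr_gt0 ?expR_gt0//.
  rewrite ler_wpM2l ?mulr_ge0 ?expR_ge0 ?ler0n//.
  by rewrite lef_pV2 ?posrE ?mulr_gt0// ler_wpM2l.
have h1 : 1 + ln n%:R <= 8 * l by lra.
split=> //; first by lra.
  have /trunc_logP : (0 < n)%N by lia.
  move=> /(_ 2%N erefl); rewrite -(ler_nat R) natrX => hT.
  have : (trunc_log 2 n)%:R * ln 2 <= ln n%:R :> R.
    rewrite mulr_natl -lnXn// ler_ln ?posrE ?exprn_gt0//.
  have t0 : 0 <= (trunc_log 2 n)%:R :> R by [].
  rewrite -natr1; nra.
have -> : 4 * (1 + ln n%:R) / 2 = 2 + (ln n%:R + ln n%:R) :> R by lra.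
rewrite (expRD 2) expRD !lnK ?posrE// natrM.
have := expR_ge1Dx (2 : R) => e2.
have : 3 * n%:R <= expR 2 * n%:R :> R by rewrite ler_wpM2r ?ler0n//; lra.
have : expR 2 * n%:R <= expR 2 * (n%:R * n%:R) :> R.
  by rewrite ler_wpM2l ?expR_ge0//; nra.
by move=> h2 h3; exact: le_trans h3 h2.
Qed.

(** The factor is [4] and not [2] because of [0 < kap]: for [y <= 1] the choice is [kap = 1], and
    [2 <= 4 * y]. *)
Lemma pow2_between (R : realType) (y : R) : 1 / 2 <= y ->
  exists2 kap, (0 < kap)%N & y <= (2 ^ kap)%:R <= 4 * y.
Proof.
move=> y0.
have ex : exists k, y <= (2 ^ k)%:R.
  exists (Num.bound y); apply: le_trans (ltW (archi_boundP _)) _; first lra.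
  by rewrite ler_nat ltnW// ltn_expl.
case: (ex_minnP ex) => -[|k] hk kmin.
  by exists 1%N => //; apply/andP; split; move: hk; rewrite ?expn0 ?expn1; lra.
exists k.+1 => //; rewrite hk/= expnS natrM.
have : ~~ (y <= (2 ^ k)%:R) by apply/negP => /kmin; rewrite ltnn.
by rewrite -ltNge; lra.
Qed.

Lemma sqrt_sum_sqr_triangle (R : rcfType) (n : nat) (a b : nat -> R) :
  Num.sqrt (\sum_(i < n) a i ^+ 2) <=
  Num.sqrt (\sum_(i < n) (a i - b i) ^+ 2) + Num.sqrt (\sum_(i < n) b i ^+ 2).
Proof.
have s0 (f : nat -> R) : 0 <= \sum_(i < n) f i ^+ 2.
  by apply: sumr_ge0 => i _; exact: sqr_ge0.
rewrite -ler_sqr ?nnegrE ?addr_ge0 ?sqrtr_ge0// sqr_sqrtr//.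
rewrite sqrrD !sqr_sqrtr// ?(s0 (fun i => a i - b i))//.
have := sum_mul_le_sqrt xpredT (fun i : 'I_n => a i - b i) (fun i : 'I_n => b i).
have -> : \sum_(i < n) a i ^+ 2 = \sum_(i < n) (a i - b i) ^+ 2 +
   2 * \sum_(i < n) (a i - b i) * b i + \sum_(i < n) b i ^+ 2.
  by rewrite mulr_sumr -!big_split/=; apply: eq_bigr => i _; ring.
by move=> h; rewrite mulr2n; lra.
Qed.

Lemma ell2_ge0 (R : realType) (n : nat) (x : 'I_n -> R) (f g : R -> R) :
  0 <= ell2 x f g.
Proof. by rewrite mulr_ge0// sumr_ge0// => i _; exact: sqr_ge0. Qed.

Lemma dist_affine_lt (R : realType) (n : nat) (x : 'I_n -> R) (f : R -> R)
    (r : R) : dist_affine x f < r ->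
  exists2 tau, affine_on `[0, 1] tau & ell2 x f tau <= r ^+ 2.
Proof.
move=> dr; have S0 : has_inf [set ell x f tau | tau in affine_on `[0, 1]].
  split; first exists (ell x f (cst 0)), (cst 0) => //.
    by exists 0, 0 => z _; rewrite mul0r addr0.
  by exists 0 => _ [tau _ <-]; exact: sqrtr_ge0.
have e0 : 0 < r - dist_affine x f by rewrite subr_gt0.
have [_ [tau tauA <-] h] := inf_adherent e0 S0.
exists tau => //.
rewrite -[leLHS]sqr_sqrtr ?ell2_ge0// ler_sqr ?nnegrE ?sqrtr_ge0//.
  by move: h; rewrite /dist_affine addrC subrK => /ltW.
apply/ltW/(le_lt_trans _ dr).
by apply: lb_le_inf S0.1 _ => _ [t _ <-]; exact: sqrtr_ge0.
Qed.

Lemma card_cells kap T :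
  #|{: bool * cell_label kap T}| = (8 * (T * 2 ^ kap))%N.
Proof. by rewrite !card_prod !card_bool !card_ord expnS; lia. Qed.

(** * Risk bound through the distance to affine functions *)

Section risk.
Variables (R : realType) (n : nat) (c1 c2 : R) (x : 'I_n -> R).
Variables (f0 : R -> R) (sigma : R) (d : measure_display).
Variables (Om : measurableType d) (P : probability Om R).
Variables (xi : 'I_n -> {RV P >-> R}) (phi_ls : Om -> R -> R) (phi0 : R -> R).
Hypothesis n_ge2 : (2 <= n)%N.
Hypothesis c1_gt0 : 0 < c1.
Hypothesis c2_gt0 : 0 < c2.
Hypothesis xdesign : design c1 c2 x.
Hypothesis sigma_gt0 : 0 < sigma.
Hypothesis xi_normal : iid_normal sigma xi.
Hypothesis lse : forall w, convex_lse x (fun i => f0 (x i) + xi i w) (phi_ls w).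
Hypothesis proj : convex_projection x f0 phi0.

Let X := nat_ext x.
Let noise w := nat_ext (fun i => xi i w).

Lemma lin_form_noise (v : nat -> R) w :
  \sum_(i < n) v i * noise w i = lin_form xi v w.
Proof. by apply: eq_bigr => i _; rewrite /noise nat_extE. Qed.

(** Noise control on the whole design for [phi_ls - tau] and [phi0 - tau], where [tau] is affine and
    [phi0 - tau] has squared norm at most [n * r ^+ 2]. [b] is the coefficient of the maximum there,
    and [s] is the free parameter of [sqr_norm_le_of_self_bound]. *)
Lemma risk_rate (kap T : nat) (s r L b : R) :
  (n < 2 ^ T)%N -> (0 < kap)%N -> 0 < s -> 0 < r -> dist_affine x phi0 < r ->
  1 <= L -> (3 * n)%:R <= expR (L / 2) ->
  b = 48 * (c2 / c1) * Num.sqrt T%:R / Num.sqrt (2 ^ kap)%:R ^+ 3 ->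
  (\int[P]_w (ell2 x (phi_ls w) phi0)%:E <=
   (n%:R^-1 * (2 * s + 256 * sigma ^+ 2 * (T * 2 ^ kap)%:R +
     72 * sigma ^+ 2 * L * b ^+ 2 * (1 + n%:R * r ^+ 2 / s)))%:E)%E.
Proof.
move=> nT kap0 s0 r0 dr L1 JL bE.
have nR : 0 < n%:R :> R by rewrite ltr0n; lia.
have [tau [ta [tb tauE]] taur] := dist_affine_lt dr.
have gap := design_gap xdesign.
have cvx f : convex01 f -> convex_seq n X (fun i => f (X i) - tau (X i)).
  move=> cf; apply: (convex_seq_sub_affine (a := ta) (b := tb)) => [i im|].
    by apply: tauE; rewrite /= in_itv/=; exact: (design01 xdesign).
  by have := convex01_seq xdesign cf (leqnn (0 + n)).
have [v [u [v1 u1 H]]] := convex_noise_control nT kap0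
  (divr_gt0 c1_gt0 nR) (divr_gt0 c2_gt0 nR) gap.
have -> : n%:R^-1 * (2 * s + 256 * sigma ^+ 2 * (T * 2 ^ kap)%:R +
     72 * sigma ^+ 2 * L * b ^+ 2 * (1 + n%:R * r ^+ 2 / s)) =
   2 * s / n%:R + 16 * (2 / n%:R) * sigma ^+ 2 * #|{: bool * cell_label kap T}|%:R +
   36 * ((2 * b ^+ 2 + 2 * b ^+ 2 * (n%:R * r ^+ 2) / s) / n%:R) * sigma ^+ 2 * L.
  by rewrite card_cells natrM; field; rewrite !gt_eqF.
have b0 : 0 <= b.
  by rewrite bE divr_ge0 ?exprn_ge0 ?sqrtr_ge0// !mulr_ge0 ?sqrtr_ge0 ?invr_ge0// ltW.
have Y0 : 0 <= n%:R * r ^+ 2 by rewrite mulr_ge0 ?sqr_ge0.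
apply: (expectation_le_quadratic sigma_gt0 xi_normal v1 u1) => //.
- by rewrite divr_ge0 ?mulr_ge0// ltW.
- have b2 : 0 <= 2 * b ^+ 2 by rewrite mulr_ge0// sqr_ge0.
  by rewrite divr_ge0// addr_ge0// divr_ge0 ?(ltW s0)// mulr_ge0.
- by rewrite card_prod card_option card_bool card_ord.
- by move=> w; exact: ell2_ge0.
move=> w N uN.
pose th1 i := phi_ls w (X i) - tau (X i).
pose th2 i := phi0 (X i) - tau (X i).
have uN' k : (\sum_(i < n) u k i * noise w i) ^+ 2 <= N.
  by rewrite lin_form_noise.
have thE : \sum_(i < n) (th1 i - th2 i) ^+ 2 =
    \sum_(i < n) (phi_ls w (x i) - phi0 (x i)) ^+ 2.
  by apply: eq_bigr => i _; rewrite /th1 /th2 /X nat_extE; congr (_ ^+ 2); ring.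
have := H (noise w) N th1 th2 uN' (cvx _ (lse w).1) (cvx _ proj.1).
have -> : c2 / n%:R / (c1 / n%:R) = c2 / c1 by field; rewrite !gt_eqF.
rewrite -bE thE => Hw.
have := basic_inequality proj (lse w).
set D2 := \sum_(i < n) (phi_ls w (x i) - phi0 (x i)) ^+ 2 in thE Hw *.
have -> : \sum_(i < n) xi i w * (phi_ls w (x i) - phi0 (x i)) =
    \sum_(i < n) noise w i * (th1 i - th2 i).
  by apply: eq_bigr => i _; rewrite /th1 /th2 /X /noise !nat_extE; congr (_ * _); ring.
move=> /le_trans /(_ Hw) {}Hw.
have ssq (f : nat -> R) : 0 <= \sum_(i < n) f i ^+ 2.
  by apply: sumr_ge0 => i _; exact: sqr_ge0.
have Ege0 : 0 <= \sum_k lin_form xi (v k) w ^+ 2.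
  by apply: sumr_ge0 => k _; exact: sqr_ge0.
have EQ : \sum_k (\sum_(i < n) v k i * noise w i) ^+ 2 =
    \sum_k lin_form xi (v k) w ^+ 2.
  by apply: eq_bigr => k _; rewrite lin_form_noise.
rewrite EQ in Hw.
have N0 : 0 <= N.
  by apply: le_trans (uN (None, Ordinal (ltnW n_ge2))); exact: sqr_ge0.
have tri := sqrt_sum_sqr_triangle n th1 th2.
rewrite thE in tri.
have D20 : 0 <= D2 by rewrite -thE; exact: (ssq (fun i => th1 i - th2 i)).
have t2Y : \sum_(i < n) th2 i ^+ 2 <= n%:R * r ^+ 2.
  rewrite mulrC -ler_pdivrMr// mulrC; apply: le_trans taur.
  rewrite /ell2 le_eqVlt; apply/orP; left; apply/eqP; congr (_ * _).
  by apply: eq_bigr => i _; rewrite /th2 /X nat_extE.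
have := sqr_norm_le_of_self_bound D20 Ege0 N0 b0 s0 (ssq th2) (ssq th1) tri t2Y Hw.
have n1 : 0 <= n%:R^-1 :> R by rewrite invr_ge0.
move=> /(ler_wpM2l n1); rewrite -/(ell2 x (phi_ls w) phi0).
move=> /le_trans; apply; rewrite le_eqVlt; apply/orP; left; apply/eqP; field.
by rewrite !gt_eqF.
Qed.

End risk.

(** * Risk bound relative to a piecewise affine function *)

Lemma threshold_index (R : realType) (n : nat) (X : nat -> R) (tau : R) :
  (forall i j, (i < j)%N -> (j < n)%N -> X i < X j) ->
  exists2 b, (b <= n)%N & forall i, (i < n)%N -> (i < b)%N = (X i < tau).
Proof.
elim: n => [|n IH] Xlt; first by exists 0%N.
have [hn|hn] := ltP (X n) tau.
  exists n.+1 => // i im; rewrite im; apply/esym.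
  move: im; rewrite ltnS leq_eqVlt => /predU1P[->//|im].
  by rewrite (lt_trans _ hn)// Xlt.
have [|b bn bP] := IH; first by move=> i j ij jn; apply: Xlt => //; exact: ltnW.
exists b; first exact: leqW.
move=> i; rewrite ltnS leq_eqVlt => /predU1P[->|im]; last exact: bP.
by rewrite ltnNge bn/= ltNge hn.
Qed.

Lemma affine_pieces_gt0 (R : realType) (alpha : R -> R) (k : nat) :
  affine_pieces alpha k -> (0 < k)%N.
Proof.
by case: k => // -[t [t0 t1 _ _]]; move: t1; rewrite t0 => /eqP; rewrite eq_sym oner_eq0.
Qed.

Lemma num_piecesP (R : realType) (alpha : R -> R) :
  (exists k, affine_pieces alpha k) -> affine_pieces alpha (num_pieces alpha).
Proof.
move=> [k0 hk0]; pose p k := `[< affine_pieces alpha k >].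
have ex : exists k, p k by exists k0; exact/asboolP.
case: (ex_minnP ex) => k /asboolP hk kmin.
rewrite /num_pieces; case: xgetP => [? ? []//|/(_ k)[]].
by split=> // j hj; apply: kmin; exact/asboolP.
Qed.

Lemma blocks_mono (b : nat -> nat) (k p q : nat) :
  (forall p, (p < k)%N -> (b p <= b p.+1)%N) -> (p <= q)%N -> (q <= k)%N ->
  (b p <= b q)%N.
Proof.
move=> mono; elim: q => [|q IH]; first by rewrite leqn0 => /eqP ->.
rewrite leq_eqVlt => /predU1P[->//|pq] qk.
by apply: leq_trans (IH pq (ltnW qk)) (mono _ qk).
Qed.

Lemma block_unique (b : nat -> nat) (k p q i : nat) :
  (forall p, (p < k)%N -> (b p <= b p.+1)%N) -> (p < k)%N -> (q < k)%N ->
  (b p <= i < b p.+1)%N -> (b q <= i < b q.+1)%N -> p = q.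
Proof.
move=> mono pk qk /andP[p1 p2] /andP[q1 q2].
case: (ltngtP p q) => // lt.
  have := leq_trans p2 (leq_trans (blocks_mono mono lt (ltnW qk)) q1).
  by rewrite ltnn.
have := leq_trans q2 (leq_trans (blocks_mono mono lt (ltnW pk)) p1).
by rewrite ltnn.
Qed.

Section pieces.
Variables (R : realType) (n : nat) (c1 c2 : R) (x : 'I_n -> R).
Hypothesis xdesign : design c1 c2 x.
Let X := nat_ext x.

Lemma affine_pieces_blocks (alpha : R -> R) (k : nat) : affine_pieces alpha k ->
  exists b : nat -> nat,
    [/\ b 0%N = 0%N, b k = n, forall p, (p < k)%N -> (b p <= b p.+1)%N &
    forall p, (p < k)%N -> exists a0 a1 : R,
      forall i, (b p <= i < b p.+1)%N -> alpha (X i) = a0 * X i + a1].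
Proof.
move=> ap; have k0 := affine_pieces_gt0 ap.
have [t [t0 t1 tlt taff]] := ap.
have /choice[b' b'P] : forall p, exists b, (b <= n)%N /\
    forall i, (i < n)%N -> (i < b)%N = (X i < t p).
  move=> p; have [b bn bP] := threshold_index (t p) (design_lt xdesign).
  by exists b.
(* The last cut is set to [n]: counting the points below [t k = 1] would lose a design point at
   [1]. *)
pose b p := if (p == k)%N then n else b' p.
have bk : b k = n by rewrite /b eqxx.
have bn p : (b p <= n)%N by rewrite /b; case: ifP => // _; have [] := b'P p.
have bE p i : (p < k)%N -> (i < n)%N -> (i < b p)%N = (X i < t p).
  by move=> pk im; rewrite /b ltn_eqF//; have [_] := b'P p; exact.
exists b; split=> // [|p pk|p pk].
- apply/eqP; rewrite -leqn0 leqNgt; apply/negP => b0.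
  have n0 : (0 < n)%N := leq_trans b0 (bn 0%N).
  move: b0; rewrite bE// t0 => h.
  by have /andP[h' _] := design01 xdesign n0; rewrite ltNge h' in h.
- have [pk'|pk'] := eqVneq p.+1 k; first by rewrite pk' bk.
  have p1k : (p.+1 < k)%N by rewrite ltn_neqAle pk'.
  rewrite leqNgt; apply/negP => bb.
  have im : (b p.+1 < n)%N := leq_trans bb (bn p).
  have := bE p _ pk im; rewrite bb => /esym h.
  have := bE p.+1 _ p1k im; rewrite ltnn => /esym/negP; apply.
  exact: lt_trans h (tlt _ pk).
have [a0 [a1 aE]] := taff _ pk.
exists a0, a1 => i /andP[bi ib]; apply: aE.
have im : (i < n)%N := leq_trans ib (bn _).
rewrite /= in_itv/=; apply/andP; split.
  by rewrite leNgt -bE// -leqNgt.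
have [pk'|pk'] := eqVneq p.+1 k.
  by rewrite pk' t1; have /andP[] := design01 xdesign im.
by rewrite ltW// -bE// ltn_neqAle pk'.
Qed.

End pieces.

Section oracle.
Variables (R : realType) (n : nat) (c1 c2 : R) (x : 'I_n -> R).
Variables (f0 : R -> R) (sigma : R) (d : measure_display).
Variables (Om : measurableType d) (P : probability Om R).
Variables (xi : 'I_n -> {RV P >-> R}) (phi_ls : Om -> R -> R) (phi0 : R -> R).
Hypothesis n_ge2 : (2 <= n)%N.
Hypothesis c1_gt0 : 0 < c1.
Hypothesis c2_gt0 : 0 < c2.
Hypothesis xdesign : design c1 c2 x.
Hypothesis sigma_gt0 : 0 < sigma.
Hypothesis xi_normal : iid_normal sigma xi.
Hypothesis lse : forall w, convex_lse x (fun i => f0 (x i) + xi i w) (phi_ls w).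
Hypothesis proj : convex_projection x f0 phi0.

Let X := nat_ext x.
Let noise w := nat_ext (fun i => xi i w).

(** On each piece [phi_ls - alpha] is convex, and the noise control is applied to it and [0]. The
    remaining noise along [alpha - phi0] costs one more form, the [1] in
    [1 + k * (8 * (T * 2 ^ kap))]. The maximum is charged once per piece, whence [k] before
    [b ^+ 2]. *)
Lemma risk_oracle (alpha : R -> R) (k kap T : nat) (L b : R) :
  affine_pieces alpha k ->
  (n < 2 ^ T)%N -> (0 < kap)%N ->
  1 <= L -> (3 * n)%:R <= expR (L / 2) ->
  b = 48 * (c2 / c1) * Num.sqrt T%:R / Num.sqrt (2 ^ kap)%:R ^+ 3 ->
  (\int[P]_w (ell2 x (phi_ls w) phi0)%:E <=
   (2 * ell2 x phi0 alpha + n%:R^-1 * (64 * sigma ^+ 2 *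
      (1 + k * (8 * (T * 2 ^ kap)))%:R +
     144 * k%:R * b ^+ 2 * sigma ^+ 2 * L))%:E)%E.
Proof.
move=> ap nT kap0 L1 JL bE.
have nR : 0 < n%:R :> R by rewrite ltr0n; lia.
have gap := design_gap xdesign.
have k0 := affine_pieces_gt0 ap.
have [bl [bl0 blk blmono blaff]] := affine_pieces_blocks xdesign ap.
have bln p : (p <= k)%N -> (bl p <= n)%N.
  by move=> pk; rewrite -blk; exact: (blocks_mono blmono pk (leqnn k)).
have /fin_all_exists[pi piP] : forall i : 'I_n, exists p : 'I_k,
    (bl p <= i < bl p.+1)%N.
  move=> i; have ex : exists p, (i < bl p)%N by exists k; rewrite blk.
  case: (ex_minnP ex) => -[|p] hp pmin; first by rewrite bl0 in hp.
  have pk : (p < k)%N by apply: pmin; rewrite blk.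
  exists (Ordinal pk) => /=; rewrite hp andbT leqNgt; apply/negP => /pmin.
  by rewrite ltnn.
have wn (p : 'I_k) : (bl p + (bl p.+1 - bl p) <= n)%N.
  by rewrite subnKC ?bln ?blmono.
have /fin_all_exists[v /fin_all_exists[u H]] := fun p : 'I_k =>
  convex_noise_control_window (wn p) nT kap0 (divr_gt0 c1_gt0 nR)
    (divr_gt0 c2_gt0 nR) gap.
pose S := \sum_(i < n) (alpha (X i) - phi0 (X i)) ^+ 2.
have S0 : 0 <= S by apply: sumr_ge0 => i _; exact: sqr_ge0.
have SE : ell2 x phi0 alpha = n%:R^-1 * S.
  congr (_ * _); apply: eq_bigr => i _; rewrite /X nat_extE; ring.
(* The unit vector along [alpha - phi0], or zero by division by zero if [S = 0]. *)
pose abar i := (alpha (X i) - phi0 (X i)) / Num.sqrt S.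
have abarE (i : 'I_n) : alpha (X i) - phi0 (X i) = Num.sqrt S * abar i.
  have [Sz|Sn] := eqVneq S 0; last first.
    by rewrite /abar mulrC divfK// sqrtr_eq0 -ltNge lt_neqAle eq_sym Sn.
  rewrite Sz sqrtr0 mul0r; move/eqP: Sz; rewrite psumr_eq0; last first.
    by move=> j _; exact: sqr_ge0.
  by move=> /allP/(_ i (mem_index_enum _)); rewrite /= sqrf_eq0 => /eqP.
pose V (c : option ('I_k * (bool * cell_label kap T))) :=
  if c is Some pc then v pc.1 pc.2 else abar.
(* Each position uses the vectors of its own piece only, so the maximum is over [3 n] forms whatever
   [k] is. *)
pose U (c : option bool * 'I_n) := u (pi c.2) c.1 c.2.
have V1 c : \sum_(i < n) V c i ^+ 2 <= 1.
  case: c => [[p c]|]; first by have [h _ _] := H p; exact: h.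
  rewrite /V /abar; under eq_bigr do rewrite expr_div_n sqr_sqrtr//.
  rewrite -mulr_suml -/S; have [->|Sn] := eqVneq S 0; first by rewrite mul0r.
  by rewrite divff.
have U1 c : \sum_(i < n) U c i ^+ 2 <= 1 by have [_ h _] := H (pi c.2); exact: h.
have -> : 2 * ell2 x phi0 alpha + n%:R^-1 * (64 * sigma ^+ 2 *
      (1 + k * (8 * (T * 2 ^ kap)))%:R + 144 * k%:R * b ^+ 2 * sigma ^+ 2 * L) =
   2 * S / n%:R + 16 * (4 / n%:R) * sigma ^+ 2 *
     #|{: option ('I_k * (bool * cell_label kap T))}|%:R +
   36 * (4 * k%:R * b ^+ 2 / n%:R) * sigma ^+ 2 * L.
  rewrite card_option card_prod card_ord card_cells SE add1n.
  by field; rewrite gt_eqF.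
apply: (expectation_le_quadratic sigma_gt0 xi_normal V1 U1) => //.
- by rewrite divr_ge0 ?mulr_ge0.
- by apply: divr_ge0 => //; apply: mulr_ge0; rewrite ?sqr_ge0 ?mulr_ge0.
- by rewrite card_prod card_option card_bool card_ord.
- by move=> w; exact: ell2_ge0.
move=> w N uN.
have N0 : 0 <= N.
  by apply: le_trans (uN (None, Ordinal (ltnW n_ge2))); exact: sqr_ge0.
pose th i := phi_ls w (X i) - alpha (X i).
have ssq (f : nat -> R) m : 0 <= \sum_(i < m) f i ^+ 2.
  by apply: sumr_ge0 => i _; exact: sqr_ge0.
pose Q p := \sum_c lin_form xi (v p c) w ^+ 2.
have Q0 p : 0 <= Q p by apply: sumr_ge0 => c _; exact: sqr_ge0.
have b0 : 0 <= b.
  by rewrite bE divr_ge0 ?exprn_ge0 ?sqrtr_ge0// !mulr_ge0 ?sqrtr_ge0 ?invr_ge0// ltW.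
(* Both products on the right are split by [d * q <= d ^+ 2 / 8 + 2 * q ^+ 2]. *)
have piece (p : 'I_k) :
    \sum_(i < bl p.+1 - bl p) noise w (bl p + i)%N * th (bl p + i)%N <=
    1 / 4 * (\sum_(i < bl p.+1 - bl p) th (bl p + i)%N ^+ 2) + 2 * Q p +
    2 * b ^+ 2 * N.
  have [_ _ /(_ (noise w) N th (fun=> 0))] := H p.
  have [a0 [a1 aE]] := blaff p (ltn_ord p).
  have cv1 : convex_seq (bl p.+1 - bl p) (fun i => X (bl p + i)%N)
      (fun i => th (bl p + i)%N).
    apply: (convex_seq_sub_affine (a := a0) (b := a1)) => [i im|].
      by apply: aE; rewrite leq_addr/= -ltn_subRL.
    exact: (convex01_seq xdesign (lse w).1 (wn p)).
  have uN' o j : (bl p <= j < bl p + (bl p.+1 - bl p))%N ->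
      (\sum_(i < n) u p o j i * noise w i) ^+ 2 <= N.
    rewrite subnKC ?blmono// => /andP[j1 j2].
    have jn : (j < n)%N := leq_trans j2 (bln _ (ltn_ord p)).
    have pij : pi (Ordinal jn) = p.
      apply: val_inj; apply: (block_unique blmono (ltn_ord _) (ltn_ord _) (piP _)).
      by rewrite /= j1.
    have := uN (o, Ordinal jn); rewrite /U/= pij -lin_form_noise.
    exact.
  move=> /(_ uN' cv1 (@convex_seq0 _ _ _)).
  have -> : c2 / n%:R / (c1 / n%:R) = c2 / c1 by field; rewrite !gt_eqF.
  rewrite -bE.
  under eq_bigr do rewrite subr0.
  under [X in _ * Num.sqrt X]eq_bigr do rewrite subr0.
  rewrite [X in _ + Num.sqrt X]big1 ?sqrtr0 ?addr0; last by move=> i _; rewrite expr0n.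
  have -> : \sum_c (\sum_(i < n) v p c i * noise w i) ^+ 2 = Q p.
    by apply: eq_bigr => c _; rewrite lin_form_noise.
  set D := \sum_(i < _) th _ ^+ 2; have D0 : 0 <= D.
    by exact: (ssq (fun i => th (bl p + i)%N)).
  have := sqr_sqrtr D0; have := sqr_sqrtr (Q0 p); have := sqr_sqrtr N0.
  move: (Num.sqrt D) (Num.sqrt (Q p)) (Num.sqrt N) => dd q nn <- <- <-.
  have := sqr_ge0 (dd - 4 * q); have := sqr_ge0 (dd - 4 * (b * nn)).
  move=> *; nra.
have sumE (F : nat -> R) : \sum_(i < n) F i =
    \sum_(p < k) \sum_(i < bl p.+1 - bl p) F (bl p + i)%N.
  by rewrite -(sum_blocks F bl0 blmono) blk.
have total : \sum_(i < n) noise w i * th i <=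
    1 / 4 * (\sum_(i < n) th i ^+ 2) + 2 * (\sum_(p < k) Q p) +
    2 * k%:R * b ^+ 2 * N.
  rewrite (sumE (fun i => noise w i * th i)) (sumE (fun i => th i ^+ 2)).
  apply: le_trans (ler_sum _ (fun p _ => piece p)) _.
  rewrite !big_split/= -!mulr_sumr sumr_const card_ord -[_ *+ k]mulr_natl.
  by rewrite le_eqVlt; apply/orP; left; apply/eqP; ring.
have basic := basic_inequality proj (lse w).
set D2 := \sum_(i < n) (phi_ls w (x i) - phi0 (x i)) ^+ 2 in basic.
have thle : \sum_(i < n) th i ^+ 2 <= 2 * D2 + 2 * S.
  rewrite /D2 /S !mulr_sumr -big_split/=; apply: ler_sum => i _.
  rewrite /th /X nat_extE.
  have := sqr_ge0 ((phi_ls w (x i) - phi0 (x i)) + (alpha (x i) - phi0 (x i))).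
  move=> *; nra.
have split : \sum_(i < n) xi i w * (phi_ls w (x i) - phi0 (x i)) =
    \sum_(i < n) noise w i * th i + Num.sqrt S * lin_form xi abar w.
  rewrite /lin_form mulr_sumr -big_split/=; apply: eq_bigr => i _.
  by rewrite mulrA -abarE /noise /th /X !nat_extE; ring.
have QV : \sum_c lin_form xi (V c) w ^+ 2 =
    lin_form xi abar w ^+ 2 + \sum_(p < k) Q p.
  rewrite /Q pair_bigA /= (bigD1 None)//=; congr (_ + _).
  rewrite (reindex_omap Some id) => [|[]//].
  by apply: eq_big => [[p c]|[p c] _]//=; rewrite eqxx.
rewrite QV /ell2 -/D2; rewrite split in basic.
have S2 := sqr_sqrtr S0.
have sq := sqr_ge0 (Num.sqrt S - lin_form xi abar w).
(* [total] and [thle] put [D2 / 2] on the right; absorbing it doubles the other terms. *)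
have fin : D2 <= 2 * S + 4 * (lin_form xi abar w ^+ 2 + \sum_(p < k) Q p) +
    4 * k%:R * b ^+ 2 * N.
  have := sqr_ge0 (lin_form xi abar w).
  move: (Num.sqrt S) S2 sq basic => rS; move=> *; nra.
have n1 : 0 <= n%:R^-1 :> R by rewrite invr_ge0.
move: fin => /(ler_wpM2l n1) /le_trans; apply.
by rewrite le_eqVlt; apply/orP; left; apply/eqP; field; rewrite !gt_eqF.
Qed.

End oracle.

(** * Choice of the parameters *)

(** [t] is the number of levels, [K] is [2 ^ kap], [s2 * z * l] is the parameter [s] of [risk_rate],
    and [4 * (s2 * z ^+ 5)] is its [n * r ^+ 2]. As [b ^+ 2] is of order [q ^+ 2 * l / z ^+ 3], all
    terms are of order [s2 * z * l] up to [1 + q ^+ 2], and [l <= 2 * y ^+ 5]. The [1] in the last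
    factor is absorbed thanks to [y <= z]. *)
Lemma rate_arithmetic (R : realType) (s2 z l y q t K L b : R) :
  0 < s2 -> l = y ^+ 4 -> 1 / 2 <= y -> y <= z -> 0 <= t -> t <= 16 * l ->
  z <= K -> K <= 4 * z -> 0 <= L -> L <= 32 * l ->
  b ^+ 2 = 48 ^+ 2 * q ^+ 2 * t / K ^+ 3 ->
  2 * (s2 * z * l) + 256 * s2 * (t * K) +
    72 * s2 * L * b ^+ 2 * (1 + 4 * (s2 * z ^+ 5) / (s2 * z * l)) <=
  10 ^+ 9 * (1 + q ^+ 2) * y ^+ 5 * (s2 * z).
Proof.
move=> s20 lE y0 yz t0 tl zK Kz L0 Ll bE.
have y_gt0 : 0 < y by lra.
have z_gt0 : 0 < z by lra.
have K_gt0 : 0 < K by lra.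
have l_gt0 : 0 < l by rewrite lE exprn_gt0.
have q20 : 0 <= q ^+ 2 := sqr_ge0 q.
have lz : l <= z ^+ 4.
  by rewrite lE lerXn2r// nnegrE ltW.
have tK : t * K <= 64 * (z * l).
  have := ler_pM t0 (ltW K_gt0) tl Kz; lra.
have bb : b ^+ 2 <= 48 ^+ 2 * 16 * q ^+ 2 * (l / z ^+ 3).
  rewrite bE.
  have h1 : K ^- 3 <= z ^- 3.
    rewrite lef_pV2 ?posrE ?exprn_gt0//.
    by rewrite lerXn2r// nnegrE ltW.
  have h2 : t * K ^- 3 <= 16 * l * z ^- 3.
    by apply: ler_pM => //; rewrite invr_ge0 exprn_ge0// ltW.
  have h3 : 0 <= 48 ^+ 2 * q ^+ 2 by rewrite mulr_ge0// exprn_ge0.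
  have := ler_wpM2l h3 h2; lra.
have f1 : 1 + 4 * (s2 * z ^+ 5) / (s2 * z * l) <= 5 * (z ^+ 4 / l).
  have -> : 4 * (s2 * z ^+ 5) / (s2 * z * l) = 4 * (z ^+ 4 / l).
    by field; rewrite !gt_eqF.
  have : 1 <= z ^+ 4 / l by rewrite ler_pdivlMr ?mul1r.
  lra.
have f0 : 0 <= 1 + 4 * (s2 * z ^+ 5) / (s2 * z * l).
  by rewrite addr_ge0// divr_ge0// ?mulr_ge0 ?exprn_ge0// ltW.
have Lb : L * b ^+ 2 <= 32 * l * (48 ^+ 2 * 16 * q ^+ 2 * (l / z ^+ 3)).
  by apply: ler_pM => //; exact: sqr_ge0.
have Lb0 : 0 <= L * b ^+ 2 by rewrite mulr_ge0// sqr_ge0.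
have third : L * b ^+ 2 * (1 + 4 * (s2 * z ^+ 5) / (s2 * z * l)) <=
    32 * 48 ^+ 2 * 16 * 5 * q ^+ 2 * (z * l).
  apply: le_trans (ler_pM Lb0 f0 Lb f1) _.
  rewrite le_eqVlt; apply/orP; left; apply/eqP; field.
  by rewrite !gt_eqF.
have ly : l <= 2 * y ^+ 5.
  have -> : 2 * y ^+ 5 = (2 * y) * l by rewrite lE; ring.
  by rewrite ler_peMl ?(ltW l_gt0)//; lra.
have zl0 : 0 <= z * l by rewrite mulr_ge0// ltW.
have zl : z * l <= 2 * (z * y ^+ 5).
  by have := ler_wpM2l (ltW z_gt0) ly; lra.
apply: (@le_trans _ _ (s2 * (10 ^+ 9 * (1 + q ^+ 2) * (z * y ^+ 5)))); last first.
  by rewrite le_eqVlt; apply/orP; left; apply/eqP; ring.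
have -> : 2 * (s2 * z * l) + 256 * s2 * (t * K) +
    72 * s2 * L * b ^+ 2 * (1 + 4 * (s2 * z ^+ 5) / (s2 * z * l)) =
   s2 * (2 * (z * l) + 256 * (t * K) +
    72 * (L * b ^+ 2 * (1 + 4 * (s2 * z ^+ 5) / (s2 * z * l)))) by ring.
rewrite ler_wpM2l ?(ltW s20)//.
have qzl := ler_wpM2l q20 zl.
have q0zl := mulr_ge0 q20 zl0.
lra.
Qed.

(** With [K] of order [y], the dimension term [t * K] and the maximum term [b ^+ 2 * L] are both of
    order [y ^+ 5], the second up to [q ^+ 2]. *)
Lemma oracle_arithmetic (R : realType) (s2 l y q t K L b k k' : R) :
  0 < s2 -> l = y ^+ 4 -> 1 / 2 <= y -> 1 <= t -> t <= 16 * l ->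
  1 <= K -> y <= K -> K <= 4 * y -> 0 <= L -> L <= 32 * l ->
  1 <= k -> k <= k' ->
  b ^+ 2 = 48 ^+ 2 * q ^+ 2 * t / K ^+ 3 ->
  64 * s2 * (1 + k * (8 * (t * K))) + 144 * k * b ^+ 2 * s2 * L <=
  10 ^+ 9 * (1 + q ^+ 2) * y ^+ 5 * (s2 * k').
Proof.
move=> s20 lE y0 t1 tl K1 yK Ky L0 Ll k1 kk bE.
have y_gt0 : 0 < y by lra.
have K_gt0 : 0 < K by lra.
have l_gt0 : 0 < l by rewrite lE exprn_gt0.
have q20 : 0 <= q ^+ 2 := sqr_ge0 q.
have tK : t * K <= 64 * y ^+ 5.
  have := ler_pM (le_trans ler01 t1) (ltW K_gt0) tl Ky.
  by rewrite lE => /le_trans; apply; rewrite le_eqVlt; apply/orP; left; apply/eqP; ring.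
have tK1 : 1 <= t * K by rewrite -[1]mul1r ler_pM.
have bb : b ^+ 2 <= 48 ^+ 2 * 16 * q ^+ 2 * y.
  rewrite bE.
  have h1 : K ^- 3 <= y ^- 3.
    rewrite lef_pV2 ?posrE ?exprn_gt0//.
    by rewrite lerXn2r// nnegrE ltW.
  have h2 : t * K ^- 3 <= 16 * l * y ^- 3.
    by apply: ler_pM => //; [lra|rewrite invr_ge0 exprn_ge0// ltW].
  have h3 : 0 <= 48 ^+ 2 * q ^+ 2 by rewrite mulr_ge0// exprn_ge0.
  have h4 : 16 * l * y ^- 3 = 16 * y by rewrite lE; field; rewrite gt_eqF.
  rewrite h4 in h2; have := ler_wpM2l h3 h2; lra.
have bL : b ^+ 2 * L <= 48 ^+ 2 * 16 * 32 * q ^+ 2 * y ^+ 5.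
  have := ler_pM (sqr_ge0 b) L0 bb Ll.
  by rewrite lE => /le_trans; apply; rewrite le_eqVlt; apply/orP; left; apply/eqP; ring.
have y50 : 0 <= y ^+ 5 by rewrite exprn_ge0// ltW.
have M0 : 0 <= 10 ^+ 9 * (1 + q ^+ 2) * y ^+ 5.
  by apply: mulr_ge0 => //; apply: mulr_ge0; [exact: exprn_ge0|lra].
apply: (@le_trans _ _ (10 ^+ 9 * (1 + q ^+ 2) * y ^+ 5 * (s2 * k))); last first.
  by rewrite ler_wpM2l// ler_wpM2l// ltW.
have k0 : 0 <= k by lra.
have -> : 10 ^+ 9 * (1 + q ^+ 2) * y ^+ 5 * (s2 * k) =
    s2 * (k * (10 ^+ 9 * (1 + q ^+ 2) * y ^+ 5)) by ring.
have -> : 64 * s2 * (1 + k * (8 * (t * K))) + 144 * k * b ^+ 2 * s2 * L =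
   s2 * (64 + k * (512 * (t * K) + 144 * (b ^+ 2 * L))) by ring.
rewrite ler_wpM2l ?(ltW s20)//.
apply: (@le_trans _ _ (k * (576 * (t * K) + 144 * (b ^+ 2 * L)))).
  have : 64 <= k * (64 * (t * K)).
    by have := ler_pM ler01 ler01 k1 tK1; lra.
  lra.
rewrite ler_wpM2l//.
have := mulr_ge0 q20 y50; lra.
Qed.

Theorem theorem6p1 (R : realType) :
  exists C : R -> R, (forall rho : R, 0 < C rho) /\
  forall (n : nat) (c1 c2 : R) (x : 'I_n -> R) (f0 : R -> R) (sigma : R)
    (d : measure_display) (T : measurableType d) (P : probability T R)
    (xi : 'I_n -> {RV P >-> R}) (phi_ls : T -> R -> R) (phi0 : R -> R),
  (2 <= n)%N -> 0 < c1 -> 0 < c2 -> design c1 c2 x ->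
  0 < sigma -> iid_normal sigma xi ->
  (forall w : T, convex_lse x (fun i => f0 (x i) + xi i w) (phi_ls w)) ->
  convex_projection x f0 phi0 ->
  let Rad : R := Num.max 1 (dist_affine x phi0) in
  let L : R := ln (expR 1 * n%:R / (2 * c1)) `^ (5 / 4) in
  C (c1 / c2) * (sigma ^+ 2 / Rad ^+ 2) * L <= n%:R ->
  ('E_P[fun w => ell2 x (phi_ls w) phi0] <=
   (C (c1 / c2) * L *
    Num.min ((sigma ^+ 2 * Num.sqrt Rad / n%:R) `^ (4 / 5))
      (inf [set (ell2 x phi0 alpha
                 + sigma ^+ 2 * (num_pieces alpha)%:R `^ (5 / 4) / n%:R)%R
           | alpha in @pw_affine_convex R]))%:E)%E.
Proof.
(* [rho] is [c1 / c2], whereas the bounds involve its inverse; [10 ^+ 9] comes from the two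
   arithmetic lemmas. *)
exists (fun rho => 10 ^+ 9 * (1 + rho^-1 ^+ 2)); split=> [rho|].
  by rewrite mulr_gt0 ?exprn_gt0// ltr_pwDl// sqr_ge0.
move=> n c1 c2 x f0 sigma d T P xi phi_ls phi0 n_ge2 c1_gt0 c2_gt0 xdesign
  sigma_gt0 xi_normal lse proj Rad L.
have c1n := design_c1_le xdesign n_ge2.
have [] := log_factor_bounds n_ge2 c1_gt0 c1n.
set l := ln (expR 1 * n%:R / (2 * c1)); set Lam := 1 + ln n%:R.
set t := (trunc_log 2 n).+1; rewrite -/l in L * => Laml Lam1 tl JL.
rewrite invf_div; set q := c2 / c1.
set Cq := 10 ^+ 9 * (1 + q ^+ 2) => hn.
have l0 : 0 < l by lra.
(* The fourth root turns [l] and [L] into [y ^+ 4] and [y ^+ 5]. *)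
pose y := l `^ (1 / 4).
have yl : l = y ^+ 4.
  rewrite /y -powR_mulrn ?powR_ge0// -powRrM.
  have -> : 1 / 4 * 4%:R = 1 :> R by lra.
  by rewrite powRr1// ltW.
have Ly : L = y ^+ 5.
  rewrite /L /y -[RHS]powR_mulrn ?powR_ge0// -powRrM.
  by congr (_ `^ _); lra.
have y0 : 0 < y by rewrite powR_gt0.
have yhalf : 1 / 2 <= y.
  rewrite leNgt; apply/negP => yl2.
  have y2 : y ^+ 2 < 1 / 4 by nra.
  have : l = y ^+ 2 * y ^+ 2 by rewrite yl; ring.
  by have := sqr_ge0 y; nra.
have Llow : 3 / 32 <= L.
  have -> : L = y * l by rewrite Ly yl; ring.
  have : 3 / 16 <= l by lra.
  nra.
have L0 : 0 < L by lra.
have nT : (n < 2 ^ t)%N.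
  have n0 : (0 < n)%N by exact: ltnW.
  by have /andP[] := trunc_log_bounds (isT : (1 < 2)%N) n0.
have t1 : 1 <= t%:R :> R by rewrite ler1n.
have Lb1 : 1 <= 4 * Lam by lra.
have Lb2 : 4 * Lam <= 32 * l by lra.
have Lb0 : 0 <= 4 * Lam by lra.
have nR : 0 < n%:R :> R by rewrite ltr0n ltnW.
have s20 : 0 < sigma ^+ 2 by rewrite exprn_gt0.
have Cq64 : 64 <= Cq.
  have : 64 <= (10 : R) ^+ 9.
    rewrite -[9%N]/(2 + 7)%N exprD; have : 1 <= (10 : R) ^+ 7.
      by rewrite exprn_ege1// ler1n.
    lra.
  have := sqr_ge0 q; rewrite /Cq; nra.
(* Covers the factor [2] before [ell2] in [risk_oracle]. *)
have CL2 : 2 <= Cq * L.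
  have : 64 * (3 / 32) <= Cq * L by apply: ler_pM => //; lra.
  by apply: le_trans; lra.
have CL0 : 0 < Cq * L by exact: lt_le_trans CL2.
have bsq kap : (48 * q * Num.sqrt t%:R / Num.sqrt (2 ^ kap)%:R ^+ 3) ^+ 2 =
    48 ^+ 2 * q ^+ 2 * t%:R / (2 ^ kap)%:R ^+ 3 :> R.
  have sq3 : (Num.sqrt (2 ^ kap)%:R ^+ 3) ^+ 2 = (2 ^ kap)%:R ^+ 3 :> R.
    by rewrite -exprM mulnC exprM sqr_sqrtr.
  by rewrite expr_div_n sq3 (exprMn _ (48 * q)) sqr_sqrtr// (exprMn _ 48).
have Rad1 : 1 <= Rad by rewrite /Rad le_max lexx.
have Rad0 : 0 < Rad by lra.
pose A := (sigma ^+ 2 * Num.sqrt Rad / n%:R) `^ (4 / 5).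
(* The rate [A] in units of [sigma ^+ 2 / n]. *)
pose z := A * n%:R / sigma ^+ 2.
have A0 : 0 < A.
  by rewrite powR_gt0// divr_gt0// mulr_gt0// sqrtr_gt0.
have z0 : 0 < z by rewrite divr_gt0// mulr_gt0.
have z5 : z ^+ 5 = n%:R * Rad ^+ 2 / sigma ^+ 2.
  have A5 : A ^+ 5 = (sigma ^+ 2 * Num.sqrt Rad / n%:R) ^+ 4.
    have base0 : 0 <= sigma ^+ 2 * Num.sqrt Rad / n%:R.
      by rewrite divr_ge0 ?mulr_ge0 ?sqrtr_ge0// ltW.
    rewrite -(powR_mulrn 4 base0) -(powR_mulrn 5 (ltW A0)) -powRrM.
    by congr (_ `^ _); lra.
  have R4 : Num.sqrt Rad ^+ 4 = Rad ^+ 2.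
    by rewrite (exprM _ 2 2) sqr_sqrtr// ltW.
  have -> : z ^+ 5 = A ^+ 5 * n%:R ^+ 5 / sigma ^+ 10.
    by rewrite /z; field; rewrite gt_eqF.
  have -> : A ^+ 5 = sigma ^+ 8 * Num.sqrt Rad ^+ 4 / n%:R ^+ 4.
    by rewrite A5; field; rewrite gt_eqF.
  by rewrite R4; field; rewrite !gt_eqF.
(* The condition on [n] enters here, in order to give [y <= z]. *)
have Lz : L <= z ^+ 5.
  apply: (@le_trans _ _ (Cq * L)); first by rewrite ler_peMl ?(ltW L0)//; lra.
  rewrite z5 ler_pdivlMr// -ler_pdivrMr ?exprn_gt0//.
  apply: le_trans hn; rewrite le_eqVlt; apply/orP; left; apply/eqP; field.
  by rewrite gt_eqF.
have yz : y <= z by rewrite -(@ler_pXn2r _ 5) ?nnegrE ?(ltW y0) ?(ltW z0)// -Ly.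
have [kap kap0 /andP[zK Kz]] := pow2_between (le_trans yhalf yz).
(* Doubling [Rad] makes the inequality strict, as [risk_rate] requires; its square is the [4] in
   [rate_arithmetic]. *)
have dr : dist_affine x phi0 < 2 * Rad.
  by apply: (@le_lt_trans _ _ Rad); [rewrite /Rad le_max lexx orbT|lra].
have r0 : 0 < 2 * Rad by lra.
have s0 : 0 < sigma ^+ 2 * z * l by rewrite mulr_gt0// mulr_gt0.
have := risk_rate n_ge2 c1_gt0 c2_gt0 xdesign sigma_gt0 xi_normal lse proj nT
  kap0 s0 r0 dr Lb1 JL erefl.
rewrite -/q natrM; set b := 48 * q * _ / _.
have -> : n%:R * (2 * Rad) ^+ 2 = 4 * (sigma ^+ 2 * z ^+ 5).
  by rewrite z5; field; rewrite gt_eqF.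
have := rate_arithmetic s20 yl yhalf yz (ler0n _ t) tl zK Kz Lb0 Lb2 (bsq kap).
rewrite -/b -/Cq -Ly => hrate Erate.
(* The bound just obtained makes the expectation finite; from here on it is a real number. *)
have [e eE e0] : exists2 e, ('E_P[fun w => ell2 x (phi_ls w) phi0] = e%:E)%E & 0 <= e.
  rewrite unlock; have : (0 <= \int[P]_w (ell2 x (phi_ls w) phi0)%:E)%E.
    by apply: integral_ge0 => w _; rewrite lee_fin ell2_ge0.
  case: (\int[P]_w _)%E Erate => [e||]; rewrite ?lee_fin//.
  by exists e.
rewrite eE lee_fin.
have rate : e <= Cq * L * A.
  rewrite -lee_fin -eE unlock; apply: le_trans Erate _; rewrite lee_fin.
  have -> : Cq * L * A = n%:R^-1 * (Cq * L * (sigma ^+ 2 * z)).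
    by rewrite /z; field; rewrite !gt_eqF.
  by rewrite ler_wpM2l ?invr_ge0.
have oracle alpha : pw_affine_convex alpha ->
    e <= Cq * L * (ell2 x phi0 alpha +
      sigma ^+ 2 * (num_pieces alpha)%:R `^ (5 / 4) / n%:R).
  move=> [_ /num_piecesP ap]; move: (num_pieces alpha) ap => k ap.
  have k1 : 1 <= k%:R :> R by rewrite ler1n; exact: affine_pieces_gt0 ap.
  (* [risk_oracle] is linear in the number of pieces, and [k >= 1] allows the power [5 / 4]. *)
  have kk : k%:R <= k%:R `^ (5 / 4) :> R.
    by rewrite -{1}[k%:R]powRr1// ler_powR//; lra.
  have [kap' kap0' /andP[yK Ky]] := pow2_between yhalf.
  have K1 : 1 <= (2 ^ kap')%:R :> R by rewrite ler1n expn_gt0.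
  have := risk_oracle n_ge2 c1_gt0 c2_gt0 xdesign sigma_gt0 xi_normal lse proj
    ap nT kap0' Lb1 JL erefl.
  have := oracle_arithmetic s20 yl yhalf t1 tl K1 yK Ky Lb0 Lb2 k1 kk (bsq kap').
  rewrite -/q -/Cq -Ly natrD !natrM => harith Eo.
  rewrite -lee_fin -eE unlock; apply: le_trans Eo _; rewrite lee_fin [leRHS]mulrDr lerD//.
    by apply: ler_wpM2r CL2; exact: ell2_ge0.
  have -> : Cq * L * (sigma ^+ 2 * k%:R `^ (5 / 4) / n%:R) =
      n%:R^-1 * (Cq * L * (sigma ^+ 2 * k%:R `^ (5 / 4))) by ring.
  by apply: ler_wpM2l; rewrite ?invr_ge0.
rewrite -/A; set I := inf _.
have Ie : e <= Cq * L * I.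
  (* Passing to the infimum requires a nonempty set: the zero function, with the knots [0] and [1],
     provides an element. *)
  rewrite mulrC -ler_pdivrMr//; apply: lb_le_inf.
    exists (ell2 x phi0 (cst 0) +
      sigma ^+ 2 * (num_pieces (cst (0 : R)))%:R `^ (5 / 4) / n%:R).
    exists (cst 0) => //; split.
      by apply/convex01P => *; rewrite !mulr0 addr0.
    exists 1%N, (fun i => i%:R); split=> // i.
      by rewrite ltr_nat ltnSn.
    by move=> _; exists 0, 0 => v _; rewrite mul0r addr0.
  by move=> _ [alpha /oracle h <-]; rewrite ler_pdivrMr// mulrC.
by rewrite /Num.min; case: ifP => _.
Qed.
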